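(* Let $p>4$ and assume that $h$ satisfies $(h_1)$ and $(h_2)$. Then equation (E) has a ground state solution $u\in H^{s,2}$, i.e. $u\in\mathcal{N}_{s,2}$, $J_{s,2}'(u)=0$ and $J_{s,2}(u)=\inf_{v\in\mathcal{N}_{s,2}}J_{s,2}(v)$.
   Context: Let $d\ge 1$ and $s\in(0,1)$. $\mathbb{Z}^d$ is the integer lattice graph (vertices $\mathbb{Z}^d$, edges between $x,y$ with $\sum_i|x_i-y_i|=1$), with graph distance $|x-y|=\sum_{i=1}^d|x_i-y_i|$ and counting measure $\mu$; $\int_{\mathbb{Z}^d}f\,d\mu:=\sum_{x\in\mathbb{Z}^d}f(x)$. The weight $w_s(x,y)$, defined for $x\neq y$, is symmetric, positive, and satisfies $c_{s,d}|x-y|^{-d-2s}\le w_s(x,y)\le C_{s,d}|x-y|^{-d-2s}$ for some constants $0<c_{s,d}\le C_{s,d}$. For $u,v:\mathbb{Z}^d\to\mathbb{R}$ set $\nabla^s u\nabla^s v(x)=\frac12\sum_{y\neq x}w_s(x,y)(u(x)-u(y))(v(x)-v(y))$, $|\nabla^s u|^2(x)=\nabla^s u\nabla^s u(x)$, $\|\nabla^s u\|_2^2:=\int_{\mathbb{Z}^d}|\nabla^s u|^2d\mu$, and $(-\Delta)^s u(x)=\sum_{y\neq x}w_s(x,y)(u(x)-u(y))$; $\|u\|_q$ denotes the $\ell^q(\mathbb{Z}^d)$ norm. Fix constants $a,b>0$ and $p>2$. The potential $h:\mathbb{Z}^d\to\mathbb{R}$ may satisfy: $(h_1)$ there is $h_0>0$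 with $h(x)\ge h_0$ for all $x$; $(h_2)$ there is $x_0\in\mathbb{Z}^d$ with $h(x)\to\infty$ as $|x-x_0|\to\infty$. $W^{s,2}(\mathbb{Z}^d)$ is the completion of finitely supported functions under $\|u\|_{W^{s,2}}^2=\int(|\nabla^s u|^2+u^2)d\mu$, and $H^{s,2}=\{u\in W^{s,2}:\int h u^2d\mu<\infty\}$ is the Hilbert space with inner product $\langle u,v\rangle_{H^{s,2}}=\int(a\nabla^s u\nabla^s v+huv)d\mu$ and norm $\|u\|_{H^{s,2}}$. Equation (E) is $\left(a+b\int_{\mathbb{Z}^d}|\nabla^s u|^2d\mu\right)(-\Delta)^s u+h(x)u=|u|^{p-2}u\log u^2$ on $\mathbb{Z}^d$ (with $|t|^{p-2}t\log t^2:=0$ at $t=0$). The energy is $J_{s,2}(u)=\frac12\|u\|_{H^{s,2}}^2+\frac b4\|\nabla^s u\|_2^4+\frac{2}{p^2}\int|u|^pd\mu-\frac1p\int|u|^p\log u^2d\mu$, a $C^1$ functional on $H^{s,2}$ with $\langle J_{s,2}'(u),\phi\rangle=\int(a\nabla^s u\nabla^s\phi+hu\phi)d\mu+b\|\nabla^s u\|_2^2\int\nabla^s u\nabla^s\phi\,d\mu-\int|u|^{p-2}u\phi\log u^2d\mu$. A weak solution is a critical point of $J_{s,2}$; nontrivial means $\neq0$. $u^+=\max\{u,0\}$, $u^-=\min\{u,0\}$. Nehari manifold: $\mathcal{N}_{s,2}=\{v\in H^{s,2}\setminus\{0\}:\langle J_{s,2}'(v),v\rangle=0\}$. Sign-changing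 Nehari set: $\mathcal{M}_{s,2}=\{v\in H^{s,2}: v^\pm\neq0,\ \langle J_{s,2}'(v),v^+\rangle=\langle J_{s,2}'(v),v^-\rangle=0\}$. A ground state solution is a nontrivial weak solution $u$ with $J_{s,2}(u)=\inf_{\mathcal{N}_{s,2}}J_{s,2}$; a sign-changing solution is a weak solution $u$ with $u^\pm\not\equiv0$; a ground state sign-changing solution is a sign-changing solution $u$ with $J_{s,2}(u)=\inf_{\mathcal{M}_{s,2}}J_{s,2}$. For $u\in H^{s,2}$, $K(u)=\sum_{x}\sum_{y\neq x}w_s(x,y)[u^+(y)u^-(x)+u^-(y)u^+(x)]$. *)

(* Defs.v *)
From mathcomp Require Import all_boot all_order all_algebra.
From mathcomp Require Import all_classical all_reals all_analysis.
Set Implicit Arguments. Unset Strict Implicit. Unset Printing Implicit Defensive.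
Import Order.TTheory GRing.Theory Num.Theory.
Local Open Scope classical_set_scope.
Local Open Scope ring_scope.

Notation Zd d := {ffun 'I_d -> int}.

Section Lattice.
Variables (R : realType) (d : nat).

Definition zdist (x y : Zd d) : nat := (\sum_(i < d) `|x i - y i|)%N.

Definition esumZ (f : Zd d -> R) : \bar R := (\esum_(x in [set: Zd d]) (f x)%:E)%E.

(* signed sum over Z^d : sum of positive part minus sum of negative part
   (meaningful when the function is absolutely summable) *)
Definition sumZ (f : Zd d -> R) : R :=
  fine (esumZ (fun x => Num.max (f x) 0)) - fine (esumZ (fun x => Num.max (- f x) 0)).

Definition sumZ_neq (x : Zd d) (f : Zd d -> R) : R :=
  sumZ (fun y => if y == x then 0 else f y).
Definition esumZ_neq (x : Zd d) (f : Zd d -> R) : \bar R :=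
  esumZ (fun y => if y == x then 0 else f y).

Variable w : Zd d -> Zd d -> R.

Definition weight_ok (s : R) : Prop :=
  (forall x y, x != y -> w x y = w y x) /\
  (forall x y, x != y -> 0 < w x y) /\
  exists c C : R, 0 < c /\ c <= C /\
    forall x y, x != y ->
      c * powR (zdist x y)%:R (- (d%:R + 2 * s)) <= w x y /\
      w x y <= C * powR (zdist x y)%:R (- (d%:R + 2 * s)).

Definition grad_prod (u v : Zd d -> R) (x : Zd d) : R :=
  2^-1 * sumZ_neq x (fun y => w x y * (u x - u y) * (v x - v y)).

Definition grad_sq (u : Zd d -> R) (x : Zd d) : \bar R :=
  ((2^-1)%:E * esumZ_neq x (fun y => (w x y * (u x - u y) ^+ 2)%R))%E.

Definition grad_norm2E (u : Zd d -> R) : \bar R :=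
  (\esum_(x in [set: Zd d]) grad_sq u x)%E.
Definition grad_norm2 (u : Zd d -> R) : R := fine (grad_norm2E u).

Definition fin_supp (phi : Zd d -> R) : Prop := finite_set [set x | phi x != 0].

Definition W_norm2E (u : Zd d -> R) : \bar R :=
  (grad_norm2E u + esumZ (fun x => (u x ^+ 2)%R))%E.

(* W^{s,2} : completion of finitely supported functions under the W-norm,
   realized as functions on Z^d (the closure of finitely supported functions) *)
Definition in_W (u : Zd d -> R) : Prop :=
  forall eps : R, 0 < eps ->
    exists phi, fin_supp phi /\ (W_norm2E (fun x => (u x - phi x)%R) < eps%:E)%E.

Variables (a b p : R) (h : Zd d -> R).

Definition in_H (u : Zd d -> R) : Prop :=
  in_W u /\ (esumZ (fun x => (h x * u x ^+ 2)%R) < +oo)%E.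

Definition H_norm2 (u : Zd d -> R) : R :=
  sumZ (fun x => a * grad_prod u u x + h x * u x ^+ 2).

(* the nonlinearity |t|^{p-2} t log t^2 (equal to 0 at t = 0) *)
Definition nonlin (t : R) : R := powR `|t| (p - 2) * t * ln (t ^+ 2).

Definition J (u : Zd d -> R) : R :=
  2^-1 * H_norm2 u + b / 4 * grad_norm2 u ^+ 2
  + 2 / p ^+ 2 * sumZ (fun x => powR `|u x| p)
  - p^-1 * sumZ (fun x => powR `|u x| p * ln (u x ^+ 2)).

Definition dJ (u phi : Zd d -> R) : R :=
  sumZ (fun x => a * grad_prod u phi x + h x * u x * phi x)
  + b * grad_norm2 u * sumZ (fun x => grad_prod u phi x)
  - sumZ (fun x => nonlin (u x) * phi x).

Definition critical (u : Zd d -> R) : Prop :=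
  forall phi, in_H phi -> dJ u phi = 0.

Definition Nehari (v : Zd d -> R) : Prop :=
  in_H v /\ v <> (fun _ => 0) /\ dJ v v = 0.

End Lattice.

(* Main.v *)
Require Import Defs.
From mathcomp Require Import all_boot all_order all_algebra.
From mathcomp Require Import finmap.
From mathcomp Require Import all_classical all_reals all_analysis.
From mathcomp Require Import ring lra zify.
Import Order.TTheory GRing.Theory Num.Theory.
Import numFieldNormedType.Exports.
Local Open Scope classical_set_scope.
Local Open Scope ring_scope.

(** The kernel is uniformly summable, since [1 + |z_i| <= 2 |z|] gives
    [|z|^-(d+2s) <= C prod_i (1 + |z_i|)^-(1+2s/d)]. Hence the gradient form is
    bounded on [l^2], and [in_H] means that the potential energy is finite.

    Write [G], [V], [P], [L] for the sums of [|grad u|^2], [h u^2], [|u|^p] and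
    [|u|^p ln u^2], and [I u = dJ u u = a G + V + b G^2 - L]. Then
    [J = Phi + I / p], where
    [Phi = (1/2 - 1/p) (a G + V) + b (1/4 - 1/p) G^2 + (2/p^2) P] is coercive as
    [p > 4]. Minimise [Phi] over [{v <> 0, I v <= 0}]: a minimising sequence
    converges pointwise along an ultrafilter, and Fatou's lemma controls [G], [V],
    [P] and also [- L], because outside a finite set of sites [h] is so large that
    [|v_n| <= 1] and [- |v_n|^p ln v_n^2 >= 0]. The limit does not vanish, because
    [I v <= 0] forces [|v x| > 1] at some site. A point [t v], [0 < t <= 1], of
    the ray of the minimiser lies on the Nehari manifold, and [Phi (t v) <= Phi v].

    Criticality: [J (t u) <= J u] on the Nehari manifold, and the ray of a one-site
    perturbation [u + r delta_z] meets the manifold near [t = 1]; comparing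
    energies as [r -> 0] from both sides gives [dJ u delta_z = 0]. Then [dJ u]
    vanishes on all of [H], being linear and bounded. *)

(** * Absolutely summable families *)

Section ESums.
Context {R : realType} {T : choiceType}.
Implicit Types (f g : T -> R) (M : R).

(** [esum] is a supremum over finite sets, and each finite set is enumerated by a duplicate-free
    list. Infinite sums can therefore be bounded through list sums. *)
Lemma esum_le_seq f M :
  (forall s : seq T, uniq s -> \sum_(x <- s) f x <= M) ->
  (\esum_(x in [set: T]) (f x)%:E <= M%:E)%E.
Proof.
move=> H; apply: ge_ereal_sup => _ [X [finX _]] <-.
rewrite (fsbig_finite _ _ finX)/= sumEFin lee_fin.
exact/H/fset_uniq.
Qed.

Lemma seq_le_esum f (s : seq T) : uniq s ->
  ((\sum_(x <- s) f x)%:E <= \esum_(x in [set: T]) (f x)%:E)%E.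
Proof.
move=> us; apply: esum_ge; exists [set` s].
  by split => //; exact: finite_seq.
by rewrite -(fsbig_seq _ _ us) sumEFin.
Qed.

Lemma sum_seq_le f M (s : seq T) :
  (\esum_(x in [set: T]) (f x)%:E <= M%:E)%E -> uniq s ->
  \sum_(x <- s) f x <= M.
Proof. by move=> H us; rewrite -lee_fin; apply: le_trans H; exact: seq_le_esum. Qed.

Lemma esum_fin_num f : (forall x, 0 <= f x) ->
  (\esum_(x in [set: T]) (f x)%:E < +oo)%E ->
  \esum_(x in [set: T]) (f x)%:E \is a fin_num.
Proof. by move=> f0 H; rewrite ge0_fin_numE// esum_ge0// => x _; rewrite lee_fin. Qed.

Lemma le_esum_scale f c : 0 <= c -> (forall x, 0 <= f x) ->
  (\esum_(x in [set: T]) (c * f x)%:E <= c%:E * \esum_(x in [set: T]) (f x)%:E)%E.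
Proof.
move=> c0 f0; have [fy|] := ltP (\esum_(x in [set: T]) (f x)%:E)%E +oo%E.
  have /fineK <- := esum_fin_num _ f0 fy.
  rewrite -EFinM; apply: esum_le_seq => s us; rewrite -mulr_sumr.
  apply: ler_wpM2l => //; apply: sum_seq_le => //.
  by rewrite fineK//; exact: esum_fin_num.
(* For an infinite sum, the case [c = 0] rests on the convention that zero times infinity is
   zero. *)
rewrite leye_eq => /eqP ->; have [->|c0'] := eqVneq c 0.
  by rewrite mul0e esum1// => x _; rewrite mul0r.
by rewrite gt0_muley ?leey// lte_fin lt_neqAle eq_sym c0'.
Qed.

Lemma esum_scale f c : 0 <= c -> (forall x, 0 <= f x) ->
  (\esum_(x in [set: T]) (c * f x)%:E = c%:E * \esum_(x in [set: T]) (f x)%:E)%E.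
Proof.
move=> c0 f0; have [->|cn0] := eqVneq c 0.
  by rewrite mul0e esum1// => x _; rewrite mul0r.
have cp : 0 < c by rewrite lt_neqAle eq_sym cn0.
apply/eqP; rewrite eq_le le_esum_scale//=.
(* The reverse inequality is [le_esum_scale] with factor [c^-1], applied to the family [c * f]. *)
rewrite -lee_pdivlMl//; apply: le_trans (le_esum_scale _ c^-1 _ _); last 2 first.
  by rewrite invr_ge0.
  by move=> x; rewrite mulr_ge0.
by apply: le_esum => x _; rewrite mulrA mulVf// mul1r.
Qed.

Lemma esum_supp1 (z : T) (c : R) : 0 <= c ->
  (\esum_(x in [set: T]) (if x == z then c else 0)%:E = c%:E)%E.
Proof.
move=> c0; rewrite -[RHS](@esum_set1 R T z (fun=> c%:E))// [RHS]esum_mkcond.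
apply: eq_esum => x _; case: ifPn => [/eqP ->|xz]; first by rewrite mem_set.
by rewrite memNset//= => /eqP; rewrite (negPf xz).
Qed.

(** Finite sums commute with pointwise limits, and the supremum over finite sets preserves the
    bound. The filter is arbitrary because limits will be taken along an ultrafilter. *)
Lemma esum_fatou (I : Type) (F : set_system I) {FF : ProperFilter F}
    (v : I -> T -> R) (f : T -> R) (m : I -> R) M :
  (forall x, v ^~ x @ F --> f x) -> m @ F --> M ->
  (forall n, forall s : seq T, uniq s -> \sum_(x <- s) v n x <= m n) ->
  (\esum_(x in [set: T]) (f x)%:E <= M%:E)%E.
Proof.
move=> vf mM H; apply: esum_le_seq => s us.
have cs : (fun n => \sum_(x <- s) v n x) @ F --> \sum_(x <- s) f x.
  elim: s {us} => [|x s IH].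
    by rewrite big_nil; under eq_fun do rewrite big_nil; exact: cvg_cst.
  rewrite big_cons; under eq_fun do rewrite big_cons.
  exact: cvgD (vf x) IH.
rewrite -subr_ge0; apply: (cvgr_to_ge (cvgB mM cs)).
by apply: filterE => n; rewrite subr_ge0; exact: H.
Qed.

End ESums.

(** * Signed sums over the lattice *)

Section Sums.
Context {R : realType} {d : nat}.
Implicit Types (f g : Zd d -> R).

(** [fine] sends an infinite sum to 0, so additivity and monotonicity of [sumZ] are stated under
    this condition. *)
Definition abs_summable f := (esumZ (fun x => `|f x|%R) < +oo)%E.

Lemma abs_summable_le f g : (forall x, `|f x| <= g x) ->
  abs_summable g -> abs_summable f.
Proof.
move=> fg; apply: le_lt_trans; apply: le_esum => x _; rewrite lee_fin.
by rewrite (le_trans (fg x))// ler_norm.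
Qed.

Lemma abs_summable_norm f : abs_summable f -> abs_summable (fun x => `|f x|).
Proof. by apply: le_lt_trans; apply: le_esum => x _; rewrite normr_id. Qed.

Lemma abs_summableD f g : abs_summable f -> abs_summable g ->
  abs_summable (fun x => f x + g x).
Proof.
move=> sf sg; apply: le_lt_trans (lte_add_pinfty sf sg).
rewrite /esumZ -esumD; try by move=> x _; rewrite lee_fin.
by apply: le_esum => x _; rewrite -EFinD lee_fin ler_normD.
Qed.

Lemma abs_summableZ c f : abs_summable f -> abs_summable (fun x => c * f x).
Proof.
rewrite /abs_summable /esumZ => sf; under eq_esum do rewrite normrM.
rewrite esum_scale// ?normr_ge0//.
have /fineK <- := esum_fin_num _ (fun x => normr_ge0 (f x)) sf.
by rewrite -EFinM ltry.
Qed.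

Lemma abs_summableN f : abs_summable f -> abs_summable (fun x => - f x).
Proof. by apply: le_lt_trans; apply: le_esum => x _; rewrite normrN. Qed.

Lemma abs_summableB f g : abs_summable f -> abs_summable g ->
  abs_summable (fun x => f x - g x).
Proof. by move=> sf sg; apply: abs_summableD => //; exact: abs_summableN. Qed.

Lemma ge0_abs_summable f : (forall x, 0 <= f x) ->
  abs_summable f = (esumZ f < +oo)%E :> Prop.
Proof. by move=> f0; congr (is_true (_ < _)%E); apply: eq_esum => x _; rewrite ger0_norm. Qed.

Lemma sumZ_ge0E f : (forall x, 0 <= f x) -> sumZ f = fine (esumZ f).
Proof.
move=> f0; rewrite /sumZ (_ : esumZ (fun x => Num.max (- f x) 0) = 0%E) ?subr0.
  by congr fine; apply: eq_esum => x _; rewrite max_l.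
by apply: esum1 => x _; rewrite max_r// oppr_le0.
Qed.

Lemma sumZ_ge0 f : (forall x, 0 <= f x) -> 0 <= sumZ f.
Proof.
by move=> f0; rewrite sumZ_ge0E// fine_ge0// esum_ge0// => x _; rewrite lee_fin.
Qed.

Lemma ge0_esumZK f : (forall x, 0 <= f x) -> abs_summable f ->
  (sumZ f)%:E = esumZ f.
Proof.
move=> f0; rewrite ge0_abs_summable// => fy; rewrite sumZ_ge0E// fineK//.
exact: esum_fin_num.
Qed.

Lemma eq_sumZ f g : f =1 g -> sumZ f = sumZ g.
Proof. by move=> /funext ->. Qed.

(** With [P] and [N] the positive and negative parts of [f - g], [P + g = N + f] holds pointwise.
    Summing and rearranging shows that every splitting into nonnegative summable functions gives the
    same value. *)
Lemma sumZ_posneg f g : (forall x, 0 <= f x) -> (forall x, 0 <= g x) ->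
  abs_summable f -> abs_summable g ->
  sumZ (fun x => f x - g x) = fine (esumZ f) - fine (esumZ g).
Proof.
move=> f0 g0 sf sg.
pose P x := Num.max (f x - g x) 0; pose N x := Num.max (- (f x - g x)) 0.
have P0 x : 0 <= P x by rewrite /P le_max lexx orbT.
have N0 x : 0 <= N x by rewrite /N le_max lexx orbT.
have sP : abs_summable P.
  apply: (@abs_summable_le _ f) => // x; rewrite ger0_norm// /P.
  by rewrite ge_max f0 andbT; have := g0 x; lra.
have sN : abs_summable N.
  apply: (@abs_summable_le _ g) => // x; rewrite ger0_norm// /N.
  by rewrite ge_max g0 andbT; have := f0 x; lra.
have E : (esumZ P + esumZ g = esumZ N + esumZ f)%E.
  rewrite /esumZ -!esumD; try by move=> x _; rewrite lee_fin.
  apply: eq_esum => x _; rewrite -!EFinD; congr EFin; rewrite /P /N.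
  by have [h|h] := leP (f x - g x) 0; [rewrite max_l|rewrite max_r]; lra.
rewrite /sumZ -/P -/N -!sumZ_ge0E//; move: E.
by rewrite -!ge0_esumZK// -!EFinD => -[]; lra.
Qed.

Let pos f x := Num.max (f x) 0.
Let neg f x := Num.max (- f x) 0.

Let pos_ge0 f x : 0 <= pos f x. Proof. by rewrite /pos le_max lexx orbT. Qed.
Let neg_ge0 f x : 0 <= neg f x. Proof. by rewrite /neg le_max lexx orbT. Qed.
Let posneg f x : f x = pos f x - neg f x.
Proof. by rewrite /pos /neg; have [h|h] := leP (f x) 0; [rewrite max_l|rewrite max_r]; lra. Qed.

Let pos_sum f : abs_summable f -> abs_summable (pos f).
Proof.
move=> sf; apply: (@abs_summable_le _ (fun x => `|f x|)) => [x|].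
  by rewrite ger0_norm// /pos ge_max ler_norm normr_ge0.
exact: abs_summable_norm.
Qed.

Let neg_sum f : abs_summable f -> abs_summable (neg f).
Proof.
move=> sf; apply: (@abs_summable_le _ (fun x => `|f x|)) => [x|].
  by rewrite ger0_norm// /neg ge_max -normrN ler_norm normr_ge0.
exact: abs_summable_norm.
Qed.

Lemma sumZD f g : abs_summable f -> abs_summable g ->
  sumZ (fun x => f x + g x) = sumZ f + sumZ g.
Proof.
move=> sf sg.
(* Cancellation between [f] and [g] makes this splitting differ from the canonical one;
   [sumZ_posneg] accepts any splitting. *)
rewrite (@eq_sumZ _ (fun x => (pos f x + pos g x) - (neg f x + neg g x))); last first.
  by move=> x; rewrite (posneg f x) (posneg g x); ring.
rewrite sumZ_posneg; try by [move=> x; rewrite addr_ge0|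
  apply: abs_summableD; do ?[exact: pos_sum|exact: neg_sum]].
have ED (u v : Zd d -> R) : (forall x, 0 <= u x) -> (forall x, 0 <= v x) ->
    abs_summable u -> abs_summable v ->
    fine (esumZ (fun x => u x + v x)) = fine (esumZ u) + fine (esumZ v).
  move=> u0 v0 su sv; rewrite /esumZ.
  under eq_esum do rewrite EFinD.
  rewrite esumD; try by move=> x _; rewrite lee_fin.
  by rewrite -/(esumZ u) -/(esumZ v) -!ge0_esumZK.
have [pf pg] := (pos_sum _ sf, pos_sum _ sg).
have [nf ng] := (neg_sum _ sf, neg_sum _ sg).
rewrite (ED _ _ (pos_ge0 f) (pos_ge0 g))// (ED _ _ (neg_ge0 f) (neg_ge0 g))//.
by rewrite /sumZ -/(pos f) -/(pos g) -/(neg f) -/(neg g); ring.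
Qed.

Lemma sumZN f : sumZ (fun x => - f x) = - sumZ f.
Proof.
rewrite /sumZ (_ : (fun x => Num.max (- - f x) 0) = pos f) ?opprB//.
by apply/funext => x; rewrite opprK.
Qed.

Lemma sumZB f g : abs_summable f -> abs_summable g ->
  sumZ (fun x => f x - g x) = sumZ f - sumZ g.
Proof. by move=> sf sg; rewrite sumZD ?sumZN//; exact: abs_summableN. Qed.

Lemma sumZZ c f : sumZ (fun x => c * f x) = c * sumZ f.
Proof.
have P (k : R) (u : Zd d -> R) : 0 <= k -> sumZ (fun x => k * u x) = k * sumZ u.
  move=> k0; have E (v : Zd d -> R) : (forall x, 0 <= v x) ->
      fine (esumZ (fun x => k * v x)) = k * fine (esumZ v).
    move=> v0; rewrite /esumZ esum_scale//; have [->|kn0] := eqVneq k 0.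
      by rewrite mul0e mul0r.
    have kp : (0 < k%:E)%E by rewrite lte_fin lt_neqAle eq_sym kn0.
    (* A positive factor keeps an infinite sum infinite, and [fine] sends both sides to 0, so
       divergent families are covered as well. *)
    by case: (\esum_(x in _) _)%E => [r| |]//=;
      rewrite ?gt0_muley ?gt0_muleNy//= mulr0.
  rewrite /sumZ mulrBr -(E (pos u))// -(E (neg u))//.
  have -> : (fun x => Num.max (k * u x) 0) = (fun x => k * pos u x).
    by apply/funext => x; rewrite maxr_pMr// mulr0.
  have -> // : (fun x => Num.max (- (k * u x)) 0) = (fun x => k * neg u x).
  by apply/funext => x; rewrite maxr_pMr// mulr0 mulrN.
have [|c0] := leP 0 c; first exact: P.
rewrite -[c]opprK mulNr -P ?oppr_ge0 1?ltW// -sumZN.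
by apply: eq_sumZ => x; ring.
Qed.

Lemma sumZ0 : sumZ (fun _ : Zd d => 0 : R) = 0.
Proof. by rewrite (@eq_sumZ _ (fun x => 0 * 0)) ?sumZZ ?mul0r// => x; rewrite mul0r. Qed.

Lemma le_sumZ f g : abs_summable f -> abs_summable g ->
  (forall x, f x <= g x) -> sumZ f <= sumZ g.
Proof.
move=> sf sg fg; rewrite -subr_ge0 -sumZB//.
by apply: sumZ_ge0 => x; rewrite subr_ge0.
Qed.

Lemma norm_sumZ f : abs_summable f -> `|sumZ f| <= sumZ (fun x => `|f x|).
Proof.
move=> sf; have sa := abs_summable_norm _ sf.
rewrite ler_norml -sumZN; apply/andP; split; apply: le_sumZ => //; last first.
- by move=> x; rewrite ler_norm.
- by move=> x; rewrite lerNl -normrN ler_norm.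
- exact: abs_summableN.
Qed.

Lemma abs_summable_supp1 (z : Zd d) (c : R) : abs_summable (fun x => if x == z then c else 0).
Proof.
apply: (@abs_summable_le _ (fun x => if x == z then `|c| else 0)).
  by move=> x; case: ifP => _; rewrite ?normr0.
rewrite ge0_abs_summable => [|x]; last by case: ifP.
by rewrite /esumZ esum_supp1// ltry.
Qed.

Lemma sumZ_supp1 (z : Zd d) (c : R) : sumZ (fun x => if x == z then c else 0) = c.
Proof.
have P (k : R) : 0 <= k -> sumZ (fun x => if x == z then k else 0) = k.
  move=> k0; rewrite sumZ_ge0E => [|x]; last by case: ifP.
  by rewrite /esumZ esum_supp1.
have [|c0] := leP 0 c; first exact: P.
rewrite -[RHS]opprK -(P (- c)) ?oppr_ge0 1?ltW// -sumZN.
by apply: eq_sumZ => x; case: ifP; rewrite ?opprK ?oppr0.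
Qed.

Lemma abs_summable_site (z : Zd d) f g : (forall x, x != z -> g x = f x) ->
  abs_summable f -> abs_summable g.
Proof.
move=> fg sf; have := abs_summableD _ _ sf (abs_summable_supp1 z (g z - f z)).
congr abs_summable; apply/funext => x; case: eqVneq => [->|/fg ->]; ring.
Qed.

(** [g] is [f] plus a multiple of the indicator of [z]. This evaluates the sums attached to one-site
    perturbations. *)
Lemma sumZ_site (z : Zd d) f g : (forall x, x != z -> g x = f x) ->
  abs_summable f -> sumZ g = sumZ f + (g z - f z).
Proof.
move=> fg sf; rewrite -{1}(sumZ_supp1 z (g z - f z)) -sumZD//; last first.
  exact: abs_summable_supp1.
by apply: eq_sumZ => x; case: eqVneq => [->|/fg ->]; ring.
Qed.

Lemma sum_seq_le_sumZ f (s : seq (Zd d)) : (forall x, 0 <= f x) ->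
  abs_summable f -> uniq s -> \sum_(x <- s) f x <= sumZ f.
Proof.
move=> f0 sf us; apply: sum_seq_le => //.
by rewrite ge0_esumZK.
Qed.

Lemma site_le_sumZ f z : (forall x, 0 <= f x) -> abs_summable f -> f z <= sumZ f.
Proof. by move=> f0 sf; have := @sum_seq_le_sumZ f [:: z] f0 sf isT; rewrite big_seq1. Qed.

(** Some finite partial sum comes within [e] of the supremum; the rest is the sum over the
    complement. *)
Lemma sumZ_tail f (e : R) : (forall x, 0 <= f x) -> abs_summable f -> 0 < e ->
  exists s : seq (Zd d), (esumZ (fun x => (if x \in s then 0 else f x)%R) < e%:E)%E.
Proof.
move=> f0 sf e0; have fK := ge0_esumZK _ f0 sf.
have : ((sumZ f - e)%:E < esumZ f)%E by rewrite -fK lte_fin; lra.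
move=> /ereal_sup_gt [_ [X [finX _] <-]].
rewrite (fsbig_finite _ _ finX)/= sumEFin lte_fin => Xe.
pose s : seq (Zd d) := fset_set X; exists s.
have sX x : (x \in s) = (x \in X) by rewrite /s in_fset_set.
have -> : esumZ (fun x => if x \in s then 0 else f x) =
    (\esum_(x in setT `&` ~` X) (f x)%:E)%E.
  rewrite esum_mkcondr; apply: eq_esum => x _.
  by rewrite in_setC sX; case: ifP.
move: fK; rewrite /esumZ (esumID X) => [|x _]; last by rewrite lee_fin.
rewrite !setTI esum_fset// => [|x _]; last by rewrite lee_fin.
rewrite (fsbig_finite _ _ finX)/= sumEFin.
case: (\esum_(i in _) _)%E => [r| |]//=; rewrite -EFinD lte_fin => -[]; lra.
Qed.

End Sums.

(** * Summability of the kernel *)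

Section Decay.
Context {R : realType}.
Implicit Types (e : R).

(** This is [ln y <= y - 1] at [y = x^-1]. *)
Lemma ln_ge_1B (x : R) : 0 < x -> 1 - x^-1 <= ln x.
Proof.
move=> x0; have xV0 : 0 < x^-1 by rewrite invr_gt0.
have := @le_ln1Dx R (x^-1 - 1).
by rewrite [1 + _]addrC subrK lnV ?posrE// ltrBDl subrr => /(_ xV0); lra.
Qed.

(** A discrete integral test. With [x = k + 1] and [y = x + 1], division by y^(-e) leaves 1 + e/y <=
    (y/x)^e, and (y/x)^e >= 1 + e ln(y/x) >= 1 + e (1 - x/y) = 1 + e/y. *)
Lemma powR_telescope e (k : nat) : 0 < e ->
  e * (k.+2%:R `^ (- (1 + e))) <= k.+1%:R `^ (- e) - k.+2%:R `^ (- e) :> R.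
Proof.
move=> e0; set x : R := k.+1%:R; set y : R := k.+2%:R.
have x0 : 0 < x by rewrite ltr0n.
have y0 : 0 < y by rewrite ltr0n.
have yx : y = x + 1 by rewrite /y /x -[k.+2]addn1 natrD.
have E : y `^ (- (1 + e)) = y^-1 * y `^ (- e).
  by rewrite opprD powRD ?(gt_eqF y0) ?implybT// powR_inv1// ltW.
have F : x `^ (- e) = (y / x) `^ e * y `^ (- e).
  have Y : y `^ e = (y / x) `^ e * x `^ e.
    by rewrite -powRM ?divfK ?gt_eqF// ?divr_ge0 ?ltW.
  rewrite !powRN Y; field.
  by rewrite !gt_eqF ?powR_gt0 ?divr_gt0.
rewrite E F mulrA -[X in _ - X]mul1r -mulrBl.
apply: ler_wpM2r; first exact: powR_ge0.
rewrite /powR (gt_eqF (divr_gt0 y0 x0))/=.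
have := expR_ge1Dx (e * ln (y / x)).
have := @ln_ge_1B (y / x) (divr_gt0 y0 x0).
rewrite invf_div => H1 H2.
have : e * (1 - x / y) <= e * ln (y / x) by rewrite ler_pM2l.
have -> : 1 - x / y = y^-1.
  by have -> : x = y - 1 by [rewrite yx addrK]; field; rewrite gt_eqF.
by move=> H3; rewrite lerBrDr (le_trans _ H2)// addrC lerD2l.
Qed.

(** The first term is 1; the others telescope to at most [e^-1]. *)
Lemma sum_decay_le e N : 0 < e ->
  \sum_(0 <= k < N) k.+1%:R `^ (- (1 + e)) <= 1 + e^-1 :> R.
Proof.
move=> e0; case: N => [|N]; first by rewrite big_nil addr_ge0// invr_ge0 ltW.
rewrite big_nat_recl//= powR1 lerD2l.
rewrite -(ler_pM2l e0) mulfV ?gt_eqF// mulr_sumr.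
apply: (@le_trans _ _ (\sum_(0 <= k < N) (k.+1%:R `^ (- e) - k.+2%:R `^ (- e)))).
  by apply: ler_sum => k _; exact: powR_telescope.
rewrite (@telescope_sumr_eq _ _ _ (fun k => - (k.+1%:R `^ (- e)))) => // [|k _].
  by rewrite opprK powR1 addrC lerBlDr lerDl powR_ge0.
by rewrite opprK addrC.
Qed.

Lemma ler_sum_subset (T : eqType) (s s' : seq T) (f : T -> R) :
  (forall x, 0 <= f x) -> uniq s -> uniq s' -> {subset s <= s'} ->
  \sum_(x <- s) f x <= \sum_(x <- s') f x.
Proof.
move=> f0 us us' ss'; rewrite [leRHS](bigID (mem s))/= -[X in X + _]big_filter.
have -> : \sum_(x <- [seq x <- s' | x \in s]) f x = \sum_(x <- s) f x.
  apply: perm_big; apply: uniq_perm => //; first exact: filter_uniq.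
  by move=> x; rewrite mem_filter/=; apply/andP/idP => [[]//|xs]; split => //; exact: ss'.
by rewrite lerDl sumr_ge0.
Qed.

Definition int_decay e (z : int) : R := (`|z|%N.+1)%:R `^ (- (1 + e)).

Lemma sum_box_le e N : 0 < e ->
  \sum_(i < N + N) int_decay e (match fintype.split i with
    inl k => Posz k | inr k => Negz k end) <= 2 * (1 + e^-1).
Proof.
move=> e0; rewrite big_split_ord/=.
under eq_bigr do rewrite (unsplitK (inl _)).
under [X in _ + X]eq_bigr do rewrite (unsplitK (inr _)).
have := sum_decay_le e N e0; rewrite big_mkord => H1.
rewrite mulr2n mulrDl mul1r; apply: lerD => //.
(* For [Negz k] the base is [k + 2], so the negative half is the sum with [N + 1] terms deprived of
   its first term. *)
have := sum_decay_le e N.+1 e0; rewrite big_mkord big_ord_recl/= => H2.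
apply: le_trans H2.
rewrite -[X in X <= _]add0r; apply: lerD; first exact: powR_ge0.
by apply: ler_sum => k _; rewrite /int_decay/=.
Qed.

(** The box of points with coordinates from [- N] to [N - 1], indexed by a finite function type so
    that products distribute over sums. [Negz k] is [- k - 1], hence the two halves do not
    overlap. *)
Definition box_point d N (f : {ffun 'I_d -> 'I_(N + N)}) : Zd d :=
  [ffun i => match fintype.split (f i) with inl k => Posz k | inr k => Negz k end].

Lemma box_point_inj d N : injective (@box_point d N).
Proof.
move=> f g /ffunP fg; apply/ffunP => i; have := fg i; rewrite !ffunE.
rewrite -[f i]splitK -[g i]splitK !unsplitK.
by case: (fintype.split (f i)) => k; case: (fintype.split (g i)) => l // [] kl;
  congr unsplit; congr (_ _); apply: val_inj.
Qed.

Lemma box_pointP d N (x : Zd d) : (forall i, `|x i|%N < N)%N ->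
  exists f, x = @box_point d N f.
Proof.
move=> H; have E i : exists k : 'I_(N + N), x i =
    match fintype.split k with inl k => Posz k | inr k => Negz k end.
  have := H i; case: (x i) => n /= Hn.
    by exists (lshift N (Ordinal Hn)); rewrite (unsplitK (inl _)).
  by exists (rshift N (Ordinal (ltnW Hn))); rewrite (unsplitK (inr _)).
have /choice [f Hf] := E.
by exists [ffun i => f i]; apply/ffunP => i; rewrite !ffunE.
Qed.

(* Distributivity turns a sum of products over a box of Z^d into the [d]-th
   power of a one-dimensional sum. *)
Lemma sum_prod_decay_le e d (s : seq (Zd d)) : 0 < e -> uniq s ->
  \sum_(x <- s) \prod_(i < d) int_decay e (x i) <= (2 * (1 + e^-1)) ^+ d.
Proof.
move=> e0 us.
(* [N] exceeds all coordinates of the points of [s] in absolute value, so the box contains [s]. *)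
pose N := (\max_(x <- s) \max_(i < d) `|x i|%N).+1.
have HN x i : x \in s -> (`|x i|%N < N)%N.
  move=> xs; rewrite ltnS /N (big_rem x xs)/=.
  by apply: leq_trans (leq_maxl _ _); exact: (@leq_bigmax _ (fun i => `|x i|%N)).
apply: (@le_trans _ _ (\sum_(x <- map (@box_point d N) (index_enum _))
    \prod_(i < d) int_decay e (x i))).
  apply: ler_sum_subset => //.
  - by move=> x; apply: prodr_ge0 => i _; exact: powR_ge0.
  - by rewrite map_inj_uniq ?index_enum_uniq//; exact: box_point_inj.
  - move=> x xs; have [i|f ->] := @box_pointP d N x; first exact: HN.
    by rewrite map_f ?mem_index_enum.
rewrite big_map; under eq_bigr do under eq_bigr do rewrite ffunE.
rewrite -(bigA_distr_bigA (fun (i : 'I_d) (j : 'I_(N + N)) =>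
  int_decay e (match fintype.split j with inl k => Posz k | inr k => Negz k end))).
rewrite prodr_const card_ord lerXn2r ?nnegrE//; last exact: sum_box_le.
  by apply: sumr_ge0 => i _; exact: powR_ge0.
by rewrite mulr_ge0// addr_ge0// invr_ge0 ltW.
Qed.

Lemma prod_int_decay_ge (s : R) d (x y : Zd d) : (0 < d)%N -> 0 < s -> x != y ->
  (zdist x y)%:R `^ (- (d%:R + 2 * s)) <=
  2 `^ (d%:R + 2 * s) * \prod_(i < d) int_decay (2 * s / d%:R) (y i - x i).
Proof.
move=> d0 s0 xy; set n := zdist x y; set e := 2 * s / d%:R.
have dR : 0 < d%:R :> R by rewrite ltr0n.
have e0 : 0 < e by rewrite divr_gt0// mulr_gt0.
have n0 : (0 < n)%N.
  rewrite lt0n; apply: contra xy; rewrite sum_nat_eq0 => /forallP H.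
  apply/eqP/ffunP => i; apply/eqP; have := H i.
  by rewrite /= absz_eq0 subr_eq0.
have nR : 0 < n%:R :> R by rewrite ltr0n.
(* This explains the choice of [e]: [d] factors of exponent [1 + e] make up the exponent
   [d + 2 s]. *)
have de : d%:R + 2 * s = (1 + e) * d%:R by rewrite /e; field; rewrite gt_eqF.
have H i : (2 * n%:R) `^ (- (1 + e)) <= int_decay e (y i - x i).
  rewrite /int_decay !powRN lef_pV2 ?posrE ?powR_gt0 ?mulr_gt0 ?ltr0n//.
  apply: ge0_ler_powR; rewrite ?nnegrE ?ler0n ?mulr_ge0//; first lra.
  rewrite -natrM ler_nat mul2n -addnn.
  have : (`|y i - x i|%N <= n)%N.
    by rewrite distnC /n /zdist (bigD1 i)//= leq_addr.
  by lia.
have : \prod_(i < d) (2 * n%:R) `^ (- (1 + e)) <=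
    \prod_(i < d) int_decay e (y i - x i).
  by apply: ler_prod => i _; rewrite powR_ge0 H.
rewrite prodr_const card_ord -powR_mulrn ?powR_ge0// -powRrM mulNr -de.
rewrite powRM ?(ltW nR)// [X in X * _]powRN mulrC ler_pdivrMr ?powR_gt0//.
by rewrite [X in _ <= X -> _]mulrC.
Qed.

Lemma sum_zdist_decay_le (s : R) d (x : Zd d) (r : seq (Zd d)) : (0 < d)%N -> 0 < s ->
  uniq r -> \sum_(y <- r | y != x) (zdist x y)%:R `^ (- (d%:R + 2 * s)) <=
  2 `^ (d%:R + 2 * s) * (2 * (1 + (2 * s / d%:R)^-1)) ^+ d.
Proof.
move=> d0 s0 us; set e := 2 * s / d%:R.
have e0 : 0 < e by rewrite divr_gt0 ?mulr_gt0// ltr0n.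
apply: (@le_trans _ _ (\sum_(y <- r) 2 `^ (d%:R + 2 * s) *
    \prod_(i < d) int_decay e (y i - x i))).
  rewrite big_mkcond; apply: ler_sum => y _; case: ifPn => yx.
    by apply: prod_int_decay_ge; rewrite // eq_sym.
  by rewrite mulr_ge0 ?powR_ge0// prodr_ge0// => i _; exact: powR_ge0.
rewrite -mulr_sumr ler_wpM2l ?powR_ge0//.
(* Translation moves [x] to the origin, which makes the bound uniform in [x]. *)
pose shift (y : Zd d) : Zd d := [ffun i => y i - x i].
apply: (@le_trans _ _ _ _ _ _ (@sum_prod_decay_le e d (map shift r) e0 _)).
  by rewrite big_map; apply: ler_sum => y _; under [leRHS]eq_bigr do rewrite ffunE.
rewrite map_inj_uniq// => y z /ffunP yz; apply/ffunP => i.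
by have := yz i; rewrite !ffunE => /addIr.
Qed.
End Decay.

(** This is all that is retained of the kernel: the power law enters the analysis only through a row
    bound uniform in [x]. *)
Definition summable_weight {R : realType} {d : nat} (w : Zd d -> Zd d -> R) (B : R) :=
  [/\ forall x y, x != y -> w x y = w y x, forall x y, x != y -> 0 <= w x y &
      forall (x : Zd d) (r : seq (Zd d)), uniq r -> \sum_(y <- r | y != x) w x y <= B].

Lemma weight_ok_summable (R : realType) (d : nat) (w : Zd d -> Zd d -> R) (s : R) :
  (0 < d)%N -> 0 < s -> weight_ok w s -> exists B, summable_weight w B.
Proof.
move=> d0 s0 [wC [w0 [c [C [c0 [cC wcC]]]]]].
exists (C * (2 `^ (d%:R + 2 * s) * (2 * (1 + (2 * s / d%:R)^-1)) ^+ d)).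
split => // [x y xy|x r ur]; first exact/ltW/w0.
apply: (@le_trans _ _ (\sum_(y <- r | y != x) C * (zdist x y)%:R `^ (- (d%:R + 2 * s)))).
  by apply: ler_sum => y yx; apply: (wcC x y _).2; rewrite eq_sym.
rewrite -mulr_sumr ler_wpM2l ?(le_trans (ltW c0))//.
exact: sum_zdist_decay_le.
Qed.

(** Tonelli's theorem for counting measures: both iterated sums are sums over pairs, matched by
    swapping components. *)
Lemma exchange_esum {R : realType} {T1 T2 : choiceType} (f : T1 -> T2 -> \bar R) :
  (forall x y, 0 <= f x y)%E ->
  (\esum_(x in [set: T1]) \esum_(y in [set: T2]) f x y =
   \esum_(y in [set: T2]) \esum_(x in [set: T1]) f x y)%E.
Proof.
move=> f0; rewrite !esum_esum//.
rewrite (reindex_esum (setT `*`` fun=> setT) _ (fun z : T2 * T1 => (z.2, z.1)))//.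
split=> //=; first by move=> [? ?] [? ?] _ _ [-> ->].
by move=> [x y] _; exists (y, x).
Qed.

(** * The gradient form *)

Section Gradient.
Context {R : realType} {d : nat}.
Variables (w : Zd d -> Zd d -> R) (B : R).
Hypothesis wB : summable_weight w B.
Implicit Types u v : Zd d -> R.

Definition square_summable u := abs_summable (fun x => u x ^+ 2).

Let l2 := square_summable.

(** [weight_ok] leaves the diagonal values of [w] free. Extending by 0 there gives a symmetric
    nonnegative kernel on all pairs. *)
Let k x y := if y == x then 0 else w x y.

Let kC x y : k x y = k y x.
Proof. by rewrite /k eq_sym; case: eqVneq => // xy; case: wB => ->. Qed.

Let k_ge0 x y : 0 <= k x y.
Proof. by rewrite /k; case: eqVneq => // xy; case: wB => _ -> //; rewrite eq_sym. Qed.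

Let k_esum x : (esumZ (k x) <= B%:E)%E.
Proof.
apply: esum_le_seq => r ur; case: wB => _ _ /(_ x r ur).
by rewrite big_mkcond; under eq_bigr do rewrite if_neg.
Qed.

Let k_summ x : abs_summable (k x).
Proof. by rewrite ge0_abs_summable//; exact: le_lt_trans (k_esum x) (ltry _). Qed.

Let k_le x y : k x y <= B.
Proof.
have := @sum_seq_le _ _ (k x) B [:: y] (k_esum x) isT.
by rewrite big_seq1.
Qed.

Let B_ge0 : 0 <= B.
Proof. exact: le_trans (k_ge0 0 0) (k_le 0 0). Qed.

Lemma summable_weight_ge0 : 0 <= B. Proof. exact: B_ge0. Qed.

Let k_sq_summ u x : l2 u -> abs_summable (fun y => k x y * u y ^+ 2).
Proof.
move=> lu; apply: (@abs_summable_le _ _ _ (fun y => B * u y ^+ 2)); last exact: abs_summableZ.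
move=> y; rewrite ger0_norm; last by rewrite mulr_ge0// sqr_ge0.
by apply: ler_wpM2r => //; exact: sqr_ge0.
Qed.

Lemma grad_prodE u v x :
  grad_prod w u v x = 2^-1 * sumZ (fun y => k x y * (u x - u y) * (v x - v y)).
Proof.
rewrite /grad_prod /sumZ_neq; congr (_ * _); apply: eq_sumZ => y.
by rewrite /k; case: ifP; rewrite ?mul0r.
Qed.

(** The summand is at most [k x y] times the sum of the squares of [u] and [v] at [x] and [y]. The
    values at [x] are summed with the row bound, those at [y] with [k x y <= B]. *)
Lemma grad_summand_summable u v x : l2 u -> l2 v ->
  abs_summable (fun y => k x y * (u x - u y) * (v x - v y)).
Proof.
move=> lu lv.
apply: (@abs_summable_le _ _ _ (fun y => (u x ^+ 2 + v x ^+ 2) * k x y +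
   B * (u y ^+ 2 + v y ^+ 2))).
  move=> y; rewrite !normrM ger0_norm//.
  set a := u x - u y; set b := v x - v y.
  have : k x y * (`|a| * `|b|) <= k x y * ((u x ^+ 2 + v x ^+ 2) + (u y ^+ 2 + v y ^+ 2)).
    apply: ler_wpM2l => //.
    have : 0 <= (`|a| - `|b|) ^+ 2 by exact: sqr_ge0.
    have a2 : `|a| ^+ 2 = a ^+ 2 by rewrite real_normK// num_real.
    have b2 : `|b| ^+ 2 = b ^+ 2 by rewrite real_normK// num_real.
    have := sqr_ge0 (u x + u y); have := sqr_ge0 (v x + v y).
    rewrite sqrrB a2 b2 /a /b; nra.
  have : k x y * (u y ^+ 2 + v y ^+ 2) <= B * (u y ^+ 2 + v y ^+ 2).
    by apply: ler_wpM2r => //; rewrite addr_ge0// sqr_ge0.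
  lra.
apply: abs_summableD; first exact: abs_summableZ.
by apply: abs_summableZ; exact: abs_summableD.
Qed.

Lemma grad_prodC u v x : grad_prod w u v x = grad_prod w v u x.
Proof. by rewrite !grad_prodE; congr (_ * _); apply: eq_sumZ => y; ring. Qed.

Lemma grad_prodD u v1 v2 x : l2 u -> l2 v1 -> l2 v2 ->
  grad_prod w u (fun y => v1 y + v2 y) x = grad_prod w u v1 x + grad_prod w u v2 x.
Proof.
move=> lu lv1 lv2; rewrite !grad_prodE -mulrDr -sumZD; do ?exact: grad_summand_summable.
by congr (_ * _); apply: eq_sumZ => y; ring.
Qed.

Lemma grad_prodZ u v c x :
  grad_prod w u (fun y => c * v y) x = c * grad_prod w u v x.
Proof. by rewrite !grad_prodE mulrCA -(sumZZ c); congr (_ * _); apply: eq_sumZ => y; ring. Qed.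

Lemma grad_prod_ge0 u x : 0 <= grad_prod w u u x.
Proof.
rewrite grad_prodE mulr_ge0// sumZ_ge0// => y.
by rewrite -mulrA -expr2 mulr_ge0// sqr_ge0.
Qed.

Lemma grad_sqE u x : l2 u -> grad_sq w u x = (grad_prod w u u x)%:E.
Proof.
move=> lu; rewrite grad_prodE EFinM /grad_sq; congr (_ * _)%E.
rewrite ge0_esumZK.
- by apply: eq_esum => y _; rewrite /k; case: ifP; rewrite ?mul0r// expr2 mulrA.
- by move=> y; rewrite -mulrA -expr2 mulr_ge0// sqr_ge0.
- exact: grad_summand_summable.
Qed.

Lemma grad_norm2E_esum u : l2 u -> grad_norm2E w u = esumZ (grad_prod w u u).
Proof. by move=> lu; apply: eq_esum => x _; exact: grad_sqE. Qed.

(** One nonnegative sum over pairs instead of an iterated sum: the form in which Fatou's lemma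
    applies to the gradient. *)
Lemma grad_norm2_pairs u : l2 u -> (2%:E * grad_norm2E w u =
  \esum_(z in [set: Zd d * Zd d]) (k z.1 z.2 * (u z.1 - u z.2) ^+ 2)%:E)%E.
Proof.
move=> lu; rewrite grad_norm2E_esum// /esumZ -esum_scale//; last exact: grad_prod_ge0.
transitivity (\esum_(x in [set: Zd d]) \esum_(y in [set: Zd d])
   (k x y * (u x - u y) ^+ 2)%:E)%E.
  apply: eq_esum => x _; rewrite grad_prodE mulrA divff// mul1r ge0_esumZK//.
  - by apply: eq_esum => y _; rewrite expr2 mulrA.
  - by move=> y; rewrite -mulrA -expr2 mulr_ge0// sqr_ge0.
  - exact: grad_summand_summable.
rewrite esum_esum; last by move=> x y _ _; rewrite lee_fin mulr_ge0// sqr_ge0.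
by congr esum; apply/seteqP; split.
Qed.

(** From (s - t)^2 <= 2 s^2 + 2 t^2: the first square is summed with the row bound, the second after
    exchanging the sums, and each contributes [B] times the squared l^2 norm. *)
Lemma grad_norm2E_le u : l2 u -> (grad_norm2E w u <= (2 * B * sumZ (fun x => (u x ^+ 2)%R))%:E)%E.
Proof.
move=> lu; rewrite grad_norm2E_esum//.
have H x : grad_prod w u u x <= B * u x ^+ 2 + sumZ (fun y => k x y * u y ^+ 2).
  have s2 := k_sq_summ u x lu.
  have kB : sumZ (k x) <= B by rewrite -lee_fin ge0_esumZK.
  have : sumZ (fun y => k x y * (u x - u y) * (u x - u y)) <=
      sumZ (fun y => (2 * u x ^+ 2) * k x y + 2 * (k x y * u y ^+ 2)).
    apply: le_sumZ; first exact: grad_summand_summable.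
      by apply: abs_summableD; exact: abs_summableZ.
    move=> y; have := sqr_ge0 (u x + u y); have := k_ge0 x y => k0 q.
    have := mulr_ge0 k0 q; nra.
  rewrite sumZD; do ?exact: abs_summableZ.
  rewrite !sumZZ grad_prodE => A.
  have : u x ^+ 2 * sumZ (k x) <= u x ^+ 2 * B by rewrite ler_wpM2l// sqr_ge0.
  lra.
apply: (@le_trans _ _ (\esum_(x in [set: Zd d]) ((B * u x ^+ 2)%:E +
    \esum_(y in [set: Zd d]) (k x y * u y ^+ 2)%:E))%E).
  apply: le_esum => x _.
  rewrite -/(esumZ (fun y => k x y * u y ^+ 2)) -ge0_esumZK -?EFinD ?lee_fin//.
    by move=> y; rewrite mulr_ge0// sqr_ge0.
  exact: k_sq_summ.
have u20 x : 0 <= u x ^+ 2 by exact: sqr_ge0.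
rewrite esumD; last 2 first.
- by move=> x _; rewrite lee_fin mulr_ge0.
- by move=> x _; apply: esum_ge0 => y _; rewrite lee_fin mulr_ge0.
rewrite exchange_esum; last by move=> x y; rewrite lee_fin mulr_ge0.
have -> : 2 * B * sumZ (fun x => u x ^+ 2) =
    B * sumZ (fun x => u x ^+ 2) + B * sumZ (fun x => u x ^+ 2) by ring.
rewrite EFinD; apply: leeD; first by rewrite esum_scale// EFinM ge0_esumZK.
rewrite EFinM ge0_esumZK// /esumZ -esum_scale//; apply: le_esum => y _.
(* By symmetry the column sum at [y] is a row sum, hence at most [B]. *)
apply: (@le_trans _ _ ((u y ^+ 2)%:E * esumZ (k y))%E).
  rewrite /esumZ -esum_scale//; apply: le_esum => x _.
  by rewrite lee_fin (kC x y) mulrC.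
by rewrite [B * _]mulrC [X in (_ <= X)%E]EFinM; apply: lee_wpmul2l; rewrite ?lee_fin.
Qed.

Lemma grad_prod_self_summable u : l2 u -> abs_summable (grad_prod w u u).
Proof.
move=> lu; rewrite ge0_abs_summable; last exact: grad_prod_ge0.
rewrite -grad_norm2E_esum//; exact: le_lt_trans (grad_norm2E_le _ lu) (ltry _).
Qed.

Lemma grad_prod_summable u v : l2 u -> l2 v -> abs_summable (grad_prod w u v).
Proof.
move=> lu lv.
apply: (@abs_summable_le _ _ _ (fun x => grad_prod w u u x + grad_prod w v v x)); last first.
  by apply: abs_summableD; exact: grad_prod_self_summable.
move=> x; rewrite !grad_prodE -mulrDr normrM ger0_norm// ler_wpM2l//.
have suv := grad_summand_summable _ _ x lu lv.
apply: le_trans (norm_sumZ _ suv) _; rewrite -sumZD; do ?exact: grad_summand_summable.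
apply: le_sumZ.
- exact: abs_summable_norm.
- by apply: abs_summableD; exact: grad_summand_summable.
move=> y; rewrite !normrM ger0_norm// -!mulrA -mulrDr ler_wpM2l// -!expr2.
set a := u x - u y; set b := v x - v y.
have := sqr_ge0 (`|a| - `|b|); rewrite sqrrB !real_normK ?num_real//.
have := sqr_ge0 a; have := sqr_ge0 b; lra.
Qed.

Lemma grad_norm2_sumZ u : l2 u -> grad_norm2 w u = sumZ (grad_prod w u u).
Proof.
by move=> lu; rewrite /grad_norm2 grad_norm2E_esum// -sumZ_ge0E//; exact: grad_prod_ge0.
Qed.

Lemma grad_norm2_ge0 u : l2 u -> 0 <= grad_norm2 w u.
Proof. by move=> lu; rewrite grad_norm2_sumZ// sumZ_ge0//; exact: grad_prod_ge0. Qed.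

Lemma grad_norm2K u : l2 u -> (grad_norm2 w u)%:E = grad_norm2E w u.
Proof.
move=> lu; rewrite grad_norm2_sumZ// grad_norm2E_esum// ge0_esumZK//.
- exact: grad_prod_ge0.
- exact: grad_prod_self_summable.
Qed.

Lemma grad_norm2_le u : l2 u -> grad_norm2 w u <= 2 * B * sumZ (fun x => u x ^+ 2).
Proof. by move=> lu; rewrite -lee_fin grad_norm2K//; exact: grad_norm2E_le. Qed.

Definition grad_form u v := sumZ (grad_prod w u v).

Lemma grad_formC u v : grad_form u v = grad_form v u.
Proof. by apply: eq_sumZ => x; exact: grad_prodC. Qed.

Lemma grad_formD u v1 v2 : l2 u -> l2 v1 -> l2 v2 ->
  grad_form u (fun y => v1 y + v2 y) = grad_form u v1 + grad_form u v2.
Proof.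
move=> lu lv1 lv2; rewrite -sumZD; do ?exact: grad_prod_summable.
by apply: eq_sumZ => x; exact: grad_prodD.
Qed.

Lemma grad_formZ u v c : grad_form u (fun y => c * v y) = c * grad_form u v.
Proof. by rewrite -sumZZ; apply: eq_sumZ => x; exact: grad_prodZ. Qed.

Lemma square_summableD u v : l2 u -> l2 v -> l2 (fun x => u x + v x).
Proof.
move=> lu lv; apply: (@abs_summable_le _ _ _ (fun x => 2 * (u x ^+ 2 + v x ^+ 2))).
  move=> x; rewrite ger0_norm ?sqr_ge0//; have := sqr_ge0 (u x - v x); nra.
by apply: abs_summableZ; exact: abs_summableD.
Qed.

Lemma square_summableZ c u : l2 u -> l2 (fun x => c * u x).
Proof.
move=> lu; apply: (@abs_summable_le _ _ _ (fun x => c ^+ 2 * u x ^+ 2)).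
  by move=> x; rewrite exprMn ger0_norm// mulr_ge0// sqr_ge0.
exact: abs_summableZ.
Qed.

(** Used with [c = 1] and [c = -1] to bound the mixed form, and with the step of a one-site
    perturbation as [c]. *)
Lemma grad_norm2D u v c : l2 u -> l2 v ->
  grad_norm2 w (fun x => u x + c * v x) =
  grad_norm2 w u + 2 * c * grad_form u v + c ^+ 2 * grad_norm2 w v.
Proof.
move=> lu lv; have lcv := square_summableZ c _ lv.
have luv := square_summableD _ _ lu lcv.
rewrite !grad_norm2_sumZ// -!/(grad_form _ _) grad_formD// grad_formZ.
rewrite (grad_formC _ u) (grad_formC _ v) !grad_formD// !grad_formZ (grad_formC v u).
ring.
Qed.

Lemma grad_norm2Z u c : l2 u ->
  grad_norm2 w (fun x => c * u x) = c ^+ 2 * grad_norm2 w u.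
Proof.
move=> lu; rewrite !grad_norm2_sumZ//; last exact: square_summableZ.
by rewrite -!/(grad_form _ _) grad_formZ grad_formC grad_formZ mulrA.
Qed.

Lemma grad_norm2_fatou (I : Type) (F : set_system I) {FF : ProperFilter F}
    (v : I -> Zd d -> R) u g :
  (forall n, l2 (v n)) -> l2 u -> (forall x, v ^~ x @ F --> u x) ->
  (fun n => grad_norm2 w (v n)) @ F --> g -> grad_norm2 w u <= g.
Proof.
move=> lv lu vu vg.
have : (2%:E * grad_norm2E w u <= (2 * g)%:E)%E.
  rewrite grad_norm2_pairs//.
  apply: (@esum_fatou _ _ _ F _
    (fun n z => k z.1 z.2 * (v n z.1 - v n z.2) ^+ 2) _ (fun n => 2 * grad_norm2 w (v n))).
  - move=> z; apply: cvgMr; rewrite expr2.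
    under eq_fun do rewrite expr2.
    by apply: cvgM; apply: cvgB; exact: vu.
  - exact: cvgMr.
  move=> n r ur; rewrite -lee_fin EFinM grad_norm2K// grad_norm2_pairs//.
  exact: (@seq_le_esum _ _ (fun z => k z.1 z.2 * (v n z.1 - v n z.2) ^+ 2)).
by rewrite -grad_norm2K// -EFinM lee_fin ler_pM2l.
Qed.

End Gradient.

(** * The scalar nonlinearity *)

Section Scalar.
Context {R : realType}.
Variable p : R.
Hypothesis p4 : 4 < p.
Implicit Types c t M : R.

Definition abs_pow t : R := `|t| `^ p.
Definition abs_pow_ln t : R := `|t| `^ p * ln (t ^+ 2).

Lemma abs_pow_ge0 t : 0 <= abs_pow t. Proof. exact: powR_ge0. Qed.

Let p0 : 0 < p. Proof. by have := p4; lra. Qed.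
Let p2 : 0 <= p - 2. Proof. by have := p4; lra. Qed.
Let p40 : 0 <= p - 4. Proof. by have := p4; lra. Qed.

Lemma abs_pow0 : abs_pow 0 = 0. Proof. by rewrite /abs_pow normr0 powR0// gt_eqF. Qed.
Lemma abs_pow_ln0 : abs_pow_ln 0 = 0. Proof. by rewrite /abs_pow_ln -/(abs_pow 0) abs_pow0 mul0r. Qed.

Lemma abs_powZ c t : 0 < c -> abs_pow (c * t) = c `^ p * abs_pow t.
Proof. by move=> c0; rewrite /abs_pow normrM powRM// gtr0_norm. Qed.

Lemma abs_pow_lnZ c t : 0 < c -> abs_pow_ln (c * t) = c `^ p * (abs_pow_ln t + ln (c ^+ 2) * abs_pow t).
Proof.
move=> c0; have [->|tn0] := eqVneq t 0.
  by rewrite mulr0 abs_pow_ln0 abs_pow0 mulr0 addr0 mulr0.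
have t2 : 0 < t ^+ 2 by rewrite exprn_even_gt0.
rewrite /abs_pow_ln -!/(abs_pow _) abs_powZ// exprMn lnM ?posrE//; first by ring.
exact: exprn_gt0.
Qed.

Lemma normr_powR_split t q : t != 0 -> `|t| `^ q = `|t| `^ (q - 2) * t ^+ 2.
Proof.
move=> tn0; have t0 : 0 < `|t| by rewrite normr_gt0.
rewrite -[t ^+ 2]real_normK ?num_real// -powR_mulrn// -powRD ?subrK//.
by rewrite (gt_eqF t0) implybT.
Qed.

Lemma nonlinM t : nonlin p t * t = abs_pow_ln t.
Proof.
rewrite /nonlin /abs_pow_ln; have [->|tn0] := eqVneq t 0.
  by rewrite mulr0 normr0 powR0 ?mul0r// gt_eqF.
by rewrite (normr_powR_split _ p)//; ring.
Qed.

Lemma abs_pow_le M t : `|t| <= M -> abs_pow t <= M `^ (p - 2) * t ^+ 2.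
Proof.
move=> tM; have [->|tn0] := eqVneq t 0; first by rewrite abs_pow0 expr0n mulr0.
rewrite /abs_pow normr_powR_split// ler_wpM2r ?sqr_ge0//.
by apply: ge0_ler_powR; rewrite ?nnegrE//; exact: le_trans tM.
Qed.

Lemma norm_ln_le c : 0 < c -> `|ln c| <= c + c^-1.
Proof.
move=> c0; have c1 : 0 < c^-1 by rewrite invr_gt0.
have := ln_sublinear c0; have := ln_sublinear c1; rewrite lnV// ?posrE// => A B'.
by rewrite ler_norml; apply/andP; split; lra.
Qed.

(** The bound |ln c| <= c + 1/c at [c = t ^+ 2] produces the powers p + 2 and p - 2 of |t|.
    Splitting off [t ^+ 2] leaves the exponents p and p - 4, both nonnegative, hence monotone in
    |t|. *)
Lemma abs_pow_ln_le M t : `|t| <= M -> `|abs_pow_ln t| <= (M `^ p + M `^ (p - 4)) * t ^+ 2.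
Proof.
move=> tM; have [->|tn0] := eqVneq t 0.
  by rewrite abs_pow_ln0 expr0n mulr0 normr0.
have t2 : 0 < t ^+ 2 by rewrite exprn_even_gt0.
have Mge : 0 <= M by exact: le_trans tM.
have mono q : 0 <= q -> `|t| `^ q <= M `^ q.
  by move=> q0; apply: ge0_ler_powR; rewrite ?nnegrE.
rewrite /abs_pow_ln normrM (ger0_norm (powR_ge0 _ _)).
apply: (@le_trans _ _ (`|t| `^ p * (t ^+ 2 + (t ^+ 2)^-1))).
  by rewrite ler_wpM2l ?powR_ge0// norm_ln_le.
rewrite mulrDr mulrDl; apply: lerD.
  by rewrite ler_wpM2r ?(ltW t2)// mono// ltW.
rewrite normr_powR_split// mulfK ?gt_eqF// normr_powR_split// ler_wpM2r ?(ltW t2)//.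
have -> : p - 2 - 2 = p - 4 by lra.
exact: mono.
Qed.

Lemma abs_pow_ln_le0 t : `|t| <= 1 -> abs_pow_ln t <= 0.
Proof.
move=> t1; rewrite /abs_pow_ln mulr_ge0_le0 ?powR_ge0// ln_le0//.
by rewrite -[t ^+ 2]real_normK ?num_real// exprn_ile1.
Qed.

Lemma norm_nonlin_le M t : `|t| <= M ->
  `|nonlin p t| <= (M `^ p + M `^ (p - 4)) * `|t|.
Proof.
move=> tM; have [->|tn0] := eqVneq t 0.
  by rewrite /nonlin mulr0 mul0r normr0 mulr0.
have t0 : 0 < `|t| by rewrite normr_gt0.
rewrite -(ler_pM2r t0) -normrM nonlinM -mulrA -expr2 real_normK ?num_real//.
exact: abs_pow_ln_le.
Qed.

Lemma is_derive_quadratic0 (f : R -> R) C :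
  (forall t, `|t| <= 1 -> `|f t| <= C * t ^+ 2) -> is_derive (0 : R) 1 f 0.
Proof.
move=> fC; have f0 : f 0 = 0.
  by apply/eqP; rewrite -normr_le0 (le_trans (fC _ _))// ?normr0// expr0n mulr0.
have E : (fun h => h^-1 *: ((f \o shift 0) (h *: 1) - f 0)) @ 0^' --> (0 : R).
  apply/cvgr0Pnorm_le => e e0.
  have C0 : 0 <= C by have := fC 1; rewrite normr1 expr1n mulr1 => /(_ (lexx _)); exact: le_trans.
  (* The radius gives [C * |h| <= e]; [C + 1] avoids a division by zero. *)
  have d0 : 0 < Num.min 1 (e / (C + 1)) by rewrite lt_min ltr01 divr_gt0//; lra.
  near=> h.
  have hn0 : h != 0 by near: h; exact: nbhs_dnbhs_neq.
  have hd : `|h| < Num.min 1 (e / (C + 1)) by near: h; exact: dnbhs0_lt.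
  move: hd; rewrite lt_min => /andP[h1 he].
  rewrite /= f0 subr0 addr0 /GRing.scale/= mulr1 normrM normfV mulrC.
  have hp : 0 < `|h| by rewrite normr_gt0.
  rewrite ler_pdivrMr// (le_trans (fC _ (ltW h1)))//.
  rewrite -[h ^+ 2]real_normK ?num_real// expr2 mulrA ler_wpM2r//.
  move: he; rewrite ltr_pdivlMr; last by lra.
  nra.
apply: DeriveDef; first by apply/cvg_ex; exists 0.
exact: cvg_lim E.
Unshelve. all: by end_near. Qed.

Let powR_sq t q : `|t| `^ q = (t ^+ 2) `^ (q / 2).
Proof.
rewrite -[t ^+ 2]real_normK ?num_real// -powR_mulrn// -powRrM.
by congr (_ `^ _); field.
Qed.

Let is_derive_sq t : is_derive t 1 (fun x : R => x ^+ 2) (2 * t).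
Proof.
have := @is_deriveX R R id 2 t 1 1 (is_derive_id _ _).
by rewrite /= expr1 /GRing.scale/= mulr1.
Qed.

Lemma is_derive_abs_pow t : is_derive t 1 abs_pow (p * (`|t| `^ (p - 2) * t)).
Proof.
have [->|tn0] := eqVneq t 0.
  rewrite !mulr0; apply: (@is_derive_quadratic0 _ (1 `^ (p - 2))) => x x1.
  by rewrite ger0_norm ?abs_pow_ge0// abs_pow_le.
have t2 : 0 < t ^+ 2 by rewrite exprn_even_gt0.
(* Writing the power through [t ^+ 2] removes the absolute value before differentiating. *)
have -> : abs_pow = (fun x => x `^ (p / 2)) \o (fun x : R => x ^+ 2).
  by apply/funext => x; rewrite /abs_pow powR_sq.
have := @is_derive1_comp _ (fun x => x `^ (p / 2)) (fun x : R => x ^+ 2) t _ _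
  (is_derive1_powR (p / 2) t2) (is_derive_sq t).
congr is_derive; rewrite powR_sq.
have -> : (p - 2) / 2 = p / 2 - 1 by field.
by field.
Qed.

Lemma is_derive_abs_pow_ln t :
  is_derive t 1 abs_pow_ln (p * nonlin p t + 2 * (`|t| `^ (p - 2) * t)).
Proof.
have [->|tn0] := eqVneq t 0.
  rewrite /nonlin !(mulr0,mul0r) addr0.
  by apply: (@is_derive_quadratic0 _ (1 `^ p + 1 `^ (p - 4))) => x x1; exact: abs_pow_ln_le.
have t2 : 0 < t ^+ 2 by rewrite exprn_even_gt0.
have dl := @is_derive1_comp _ (@ln R) (fun x : R => x ^+ 2) t _ _
  (is_derive1_ln t2) (is_derive_sq t).
have := @is_deriveM R R _ _ t 1 _ _ (is_derive_abs_pow t) dl.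
have -> : abs_pow * (@ln R \o (fun x => x ^+ 2)) = abs_pow_ln by apply/funext => x.
congr is_derive; rewrite /GRing.scale/= /nonlin /abs_pow normr_powR_split//.
by field.
Qed.

Lemma is_derive_continuous (f : R -> R) t df : is_derive t 1 f df -> {for t, continuous f}.
Proof. by move=> [/derivable1_diffP/differentiable_continuous]. Qed.

Lemma abs_pow_continuous : continuous abs_pow.
Proof. by move=> t; exact: is_derive_continuous (is_derive_abs_pow t). Qed.

Lemma abs_pow_ln_continuous : continuous abs_pow_ln.
Proof. by move=> t; exact: is_derive_continuous (is_derive_abs_pow_ln t). Qed.

Lemma is_derive_quotient (f : R -> R) t df : is_derive t 1 f df ->
  (fun h => h^-1 * (f (t + h) - f t)) @ 0^' --> df.
Proof.
move=> [dft <-]; have := dft; rewrite /derivable => H.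
suff -> : (fun h => h^-1 * (f (t + h) - f t)) =
  (fun h => h^-1 *: ((f \o shift t) (h *: 1) - f t)) by exact: H.
by apply/funext => h; rewrite /= /GRing.scale/= mulr1 addrC [h + t]addrC [RHS]mulrC mulrC addrC.
Qed.

(* Young's inequality with exponent [p / n]. *)
Lemma expr_powR_le n t : (0 < n)%N -> n%:R < p -> 0 < t ->
  (1 - t `^ p) / p <= (1 - t ^+ n) / n%:R.
Proof.
move=> n0 np t0; have nR : 0 < n%:R :> R by rewrite ltr0n.
have nn : n%:R != 0 :> R by rewrite gt_eqF.
have pn : p != 0 by rewrite gt_eqF.
have pnn : p - n%:R != 0 by rewrite gt_eqF// subr_gt0.
have q0 : 0 < p / (p - n%:R) by rewrite divr_gt0// subr_gt0.
have := @conjugate_powR R (t ^+ n) 1 (p / n%:R) (p / (p - n%:R)) _ ler01 (divr_gt0 p0 nR) q0 _.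
rewrite exprn_ge0 ?(ltW t0)// mulr1 powR1 -powR_mulrn ?(ltW t0)// -powRrM.
have -> : n%:R * (p / n%:R) = p by field.
have E : (p / n%:R)^-1 + (p / (p - n%:R))^-1 = 1 by field; rewrite pn pnn nn.
move=> /(_ isT E).
rewrite !invf_div mul1r => H.
have {}H := ler_wpM2r (ltW (divr_gt0 ltr01 nR)) H.
have -> : (1 - t `^ p) / p = (1 - t `^ p * (n%:R / p)  - (p - n%:R) / p) * (1 / n%:R).
  by field; rewrite pn nn.
have -> : (1 - t `^ n%:R) / n%:R = (1 - t `^ n%:R) * (1 / n%:R) by field.
apply: ler_wpM2r; first by rewrite divr_ge0.
have nz : 0 < 1 / n%:R :> R by rewrite divr_gt0.
by move: H; rewrite ler_pM2r//; lra.
Qed.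

Lemma xlnx_ge t : 0 < t -> t - 1 <= t * ln t.
Proof.
move=> t0; have := ln_ge_1B t t0 => H.
have := ler_wpM2l (ltW t0) H; rewrite mulrBr mulr1 mulfV ?gt_eqF//.
Qed.

End Scalar.

(** * Ultrafilter limits, finite balls and Fatou's lemma *)

Lemma ultra_bounded_cvg (R : realType) (T : Type) (U : set_system T) (f : T -> R) M :
  UltraFilter U -> (forall n, `|f n| <= M) -> exists l : R, f @ U --> l.
Proof.
move=> UU fM; have FF : ProperFilter (f @ U) by apply: fmap_proper_filter.
have fI : (f @ U) `[- M, M]%classic.
  by apply: (@filterE _ U) => n /=; rewrite in_itv/= -ler_norml.
(* Compactness gives a cluster point. An ultrafilter contains the preimage of each neighbourhood of
   it or of the complement, and the latter contradicts clustering. *)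
have [l [_ cl]] := @segment_compact R (- M) M (f @ U) FF fI.
exists l => N Nl; have [//|H] := in_ultra_setVsetC (f @^-1` N) UU.
by have [x []] := cl (~` N) N H Nl.
Qed.

Lemma zball_finite d (x0 : Zd d) (r : nat) :
  exists s : seq (Zd d), forall x, (zdist x x0 <= r)%N -> x \in s.
Proof.
exists [seq [ffun i => x0 i + @box_point d r.+1 f i] | f <- index_enum _] => x xr.
pose y : Zd d := [ffun i => x i - x0 i].
have [i|f yf] := @box_pointP d r.+1 y.
  rewrite ffunE ltnS (leq_trans _ xr)// /zdist (bigD1 i)//= leq_addr//.
apply/mapP; exists f; first exact: mem_index_enum.
by apply/ffunP => i; rewrite ffunE -yf ffunE addrC subrK.
Qed.

Section SumsFinite.
Context {R : realType} {d : nat}.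

Lemma abs_summable_finsupp (s : seq (Zd d)) (c : R) :
  abs_summable (fun x => if x \in s then c else 0).
Proof.
elim: s => [|z s IH].
  by apply: (@abs_summable_le _ _ _ (fun x => if x == 0 then 0 else 0)) => [x|];
    [rewrite normr0; case: ifP|exact: abs_summable_supp1].
by apply: (@abs_summable_site _ _ z _ _ _ IH) => x xz; rewrite inE (negPf xz).
Qed.

Lemma sumZ_fatou (I : Type) (F : set_system I) {FF : ProperFilter F}
    (f : I -> Zd d -> R) (g : Zd d -> R) M :
  (forall n x, 0 <= f n x) -> (forall n, abs_summable (f n)) ->
  (forall x, f ^~ x @ F --> g x) -> (fun n => sumZ (f n)) @ F --> M ->
  abs_summable g /\ sumZ g <= M.
Proof.
move=> f0 sf fg fM.
have g0 x : 0 <= g x.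
  by apply: (cvgr_to_ge (fg x)); apply: filterE => n; exact: f0.
have E : (esumZ g <= M%:E)%E.
  apply: (esum_fatou _ _ _ _ _ _ fg fM) => n r ur.
  exact: sum_seq_le_sumZ.
have sg : abs_summable g.
  by rewrite ge0_abs_summable//; exact: le_lt_trans E (ltry _).
by split => //; rewrite -lee_fin ge0_esumZK.
Qed.
End SumsFinite.

(** * The Nehari functional along rays *)

Section Ray.
Context {R : realType}.
Variable p : R.

(* [I(t v)] as a function of [t], with [A], [C], [P], [L] the homogeneous parts of [I(v)]. *)
Definition ray (A C P L t : R) : R :=
  t ^+ 2 * A + t ^+ 4 * C - t `^ p * (L + ln (t ^+ 2) * P).

Lemma powR_continuous_at (t : R) : 0 < t -> (fun x => x `^ p) @ t --> t `^ p.
Proof. by move=> t0; exact: is_derive_continuous _ _ _ (is_derive1_powR p t0). Qed.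

Lemma ln_sq_continuous_at (t : R) : 0 < t -> (fun x => ln (x ^+ 2)) @ t --> ln (t ^+ 2).
Proof.
move=> t0; apply: (@continuous_comp _ _ _ (fun x : R => x ^+ 2) (@ln R)).
  exact: exprn_continuous.
by apply: continuous_ln; exact: exprn_gt0.
Qed.

Lemma ray_continuous A C P L (t : R) : 0 < t -> {for t, continuous (ray A C P L)}.
Proof.
move=> t0; apply: cvgB; first apply: cvgD.
- by apply: cvgM; [exact: exprn_continuous|exact: cvg_cst].
- by apply: cvgM; [exact: exprn_continuous|exact: cvg_cst].
apply: cvgM; first exact: powR_continuous_at.
apply: cvgD; first exact: cvg_cst.
by apply: cvgM; [exact: ln_sq_continuous_at|exact: cvg_cst].
Qed.

Lemma ray_root A C P L (t0 t1 : R) : 0 < t0 -> t0 <= t1 ->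
  0 <= ray A C P L t0 -> ray A C P L t1 <= 0 ->
  exists2 t, t0 <= t <= t1 & ray A C P L t = 0.
Proof.
move=> t00 t01 r0 r1.
have [||c] := @IVT R (ray A C P L) t0 t1 0 t01.
- apply: continuous_in_subspaceT => x; rewrite inE/= in_itv/= => /andP[tx _].
  by apply: ray_continuous; exact: lt_le_trans tx.
- by rewrite ge_min r1 orbT le_max r0.
by rewrite in_itv/= => ? ?; exists c.
Qed.
End Ray.

Lemma cvg_to_eq (T : Type) (R : realType) (F : set_system T) (f : T -> R) (l l' : R) :
  l = l' -> f @ F --> l -> f @ F --> l'.
Proof. by move=> ->. Qed.

(** * The energy and its minimisation *)

Section Energy.
Context {R : realType} {d : nat}.
Variables (w : Zd d -> Zd d -> R) (B a b p : R) (h : Zd d -> R) (h0 : R).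
Hypotheses (wB : summable_weight w B) (a0 : 0 < a) (b0 : 0 < b) (p4 : 4 < p).
Hypotheses (h00 : 0 < h0) (hh : forall x, h0 <= h x).
Implicit Types u v phi : Zd d -> R.

(** Membership in the energy space, by [in_H_finite_potential]. *)
Definition finite_potential u := abs_summable (fun x => h x * u x ^+ 2).

Let Hs := finite_potential.
Let G := grad_norm2 w.
Let V u := sumZ (fun x => h x * u x ^+ 2).
Let P u := sumZ (fun x => abs_pow p (u x)).
Let L u := sumZ (fun x => abs_pow_ln p (u x)).

Let h_ge0 x : 0 <= h x. Proof. exact: le_trans (ltW h00) (hh x). Qed.
Let hu_ge0 u x : 0 <= h x * u x ^+ 2. Proof. by rewrite mulr_ge0// sqr_ge0. Qed.
Let p0 : 0 < p. Proof. by have := p4; lra. Qed.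

Lemma finite_potential_le u v : (forall x, `|u x| <= `|v x|) -> Hs v -> Hs u.
Proof.
move=> uv; apply: abs_summable_le => x; rewrite ger0_norm// ler_wpM2l//.
by rewrite -[u x ^+ 2]real_normK ?num_real// -[v x ^+ 2]real_normK ?num_real// lerXn2r ?nnegrE.
Qed.

Lemma finite_potential_l2 u : Hs u -> square_summable u.
Proof.
move=> /(abs_summableZ h0^-1); apply: abs_summable_le => x.
rewrite ger0_norm ?sqr_ge0// mulrA ler_peMl ?sqr_ge0//.
by rewrite mulrC ler_pdivlMr// mul1r.
Qed.

Lemma finite_potentialZ c u : Hs u -> Hs (fun x => c * u x).
Proof.
move=> /(abs_summableZ (c ^+ 2)); congr (is_true (abs_summable _)).
by apply/funext => x; ring.
Qed.

Lemma finite_potentialD u v : Hs u -> Hs v -> Hs (fun x => u x + v x).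
Proof.
move=> su sv; have := abs_summableZ 2 _ (abs_summableD _ _ su sv).
apply: abs_summable_le => x; rewrite ger0_norm; last by rewrite mulr_ge0// sqr_ge0.
have := h_ge0 x; have := sqr_ge0 (u x - v x) => q k.
have := mulr_ge0 k q; nra.
Qed.

Lemma finite_potential_site u v (z : Zd d) : (forall x, x != z -> v x = u x) ->
  Hs u -> Hs v.
Proof. by move=> uv; apply: (@abs_summable_site _ _ z) => x /uv ->. Qed.

Lemma potential_sq_le u x : Hs u -> h x * u x ^+ 2 <= V u.
Proof. by move=> su; exact: (@site_le_sumZ _ _ (fun x => h x * u x ^+ 2)). Qed.

(** The square of [u x] is at most [M / h0]; the inequality 2 t <= 1 + t^2 turns this into a bound
    without square root. *)
Lemma potential_bound u M x : Hs u -> V u <= M -> `|u x| <= 1 + M / h0.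
Proof.
move=> su uM; have := le_trans (potential_sq_le u x su) uM => H.
have : u x ^+ 2 <= M / h0.
  rewrite ler_pdivlMr// mulrC; apply: le_trans H.
  by rewrite ler_wpM2r ?sqr_ge0.
have := sqr_ge0 (`|u x| - 1); rewrite -[u x ^+ 2]real_normK ?num_real//.
have := normr_ge0 (u x); move: (`|u x|) (M / h0) => t m; nra.
Qed.

Let bnd M := 1 + M / h0.

Lemma abs_pow_summable u : Hs u -> abs_summable (fun x => abs_pow p (u x)).
Proof.
move=> su; have := finite_potential_l2 u su.
move/(abs_summableZ (bnd (V u) `^ (p - 2))); apply: abs_summable_le => x.
by rewrite ger0_norm ?abs_pow_ge0// abs_pow_le// potential_bound.
Qed.

Lemma norm_abs_pow_ln_le u M x : Hs u -> V u <= M ->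
  `|abs_pow_ln p (u x)| <= (bnd M `^ p + bnd M `^ (p - 4)) * u x ^+ 2.
Proof. by move=> su uM; rewrite abs_pow_ln_le// potential_bound. Qed.

Lemma abs_pow_ln_summable u : Hs u -> abs_summable (fun x => abs_pow_ln p (u x)).
Proof.
move=> su; have := finite_potential_l2 u su.
move/(abs_summableZ (bnd (V u) `^ p + bnd (V u) `^ (p - 4))).
by apply: abs_summable_le => x; exact: norm_abs_pow_ln_le.
Qed.

Lemma nonlin_summable u phi : Hs u -> Hs phi ->
  abs_summable (fun x => nonlin p (u x) * phi x).
Proof.
move=> su sphi; set c := bnd (V u) `^ p + bnd (V u) `^ (p - 4).
have c0 : 0 <= c by rewrite addr_ge0 ?powR_ge0.
have := abs_summableZ c _ (abs_summableD _ _ (finite_potential_l2 u su) (finite_potential_l2 phi sphi)).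
apply: abs_summable_le => x; rewrite normrM.
apply: (@le_trans _ _ (c * `|u x| * `|phi x|)).
  by rewrite ler_wpM2r// norm_nonlin_le// potential_bound.
rewrite -mulrA ler_wpM2l// -[u x ^+ 2]real_normK ?num_real// -[phi x ^+ 2]real_normK ?num_real//.
have := sqr_ge0 (`|u x| - `|phi x|); have := sqr_ge0 (`|u x| + `|phi x|); nra.
Qed.

Lemma potential_summable u phi : Hs u -> Hs phi ->
  abs_summable (fun x => h x * u x * phi x).
Proof.
move=> su sphi; have := abs_summableD _ _ su sphi.
apply: abs_summable_le => x; rewrite !normrM ger0_norm// -mulrA -mulrDr ler_wpM2l//.
rewrite -[u x ^+ 2]real_normK ?num_real// -[phi x ^+ 2]real_normK ?num_real//.
have := sqr_ge0 (`|u x| - `|phi x|); have := sqr_ge0 (`|u x| + `|phi x|); nra.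
Qed.

(** For the closure condition, [u] is truncated to finite sets: it is square summable since
    [h0 <= h], and the gradient form is bounded on l^2, so the tails are small in the W-norm. *)
Lemma in_H_finite_potential u : in_H w h u <-> Hs u.
Proof.
split=> [[_]|su]; first by rewrite /Hs /finite_potential ge0_abs_summable.
split; last by move: su; rewrite /Hs /finite_potential ge0_abs_summable.
have lu := finite_potential_l2 u su => e e0.
have B0 := summable_weight_ge0 _ _ wB.
(* The squared W-norm of a tail is at most [2 * B + 1] times its squared l^2 norm. *)
have [|s Hsm] := @sumZ_tail _ _ (fun x => u x ^+ 2) (e / (2 * B + 1)) (fun x => sqr_ge0 _) lu.
  by rewrite divr_gt0//; lra.
exists (fun x => if x \in s then u x else 0); split.
  apply: (@sub_finite_set _ _ [set` s]); last exact: finite_seq.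
  by move=> x /=; case: ifP => //; rewrite eqxx.
pose t x := if x \in s then 0 else u x.
have -> : (fun x => u x - (if x \in s then u x else 0)) = t.
  by apply/funext => x; rewrite /t; case: ifP; rewrite ?subrr ?subr0.
have lt : square_summable t.
  apply: finite_potential_l2; apply: finite_potential_le su => x.
  by rewrite /t; case: ifP; rewrite ?normr0.
have tE : esumZ (fun x => t x ^+ 2) = (sumZ (fun x => t x ^+ 2))%:E.
  by rewrite ge0_esumZK// => x; exact: sqr_ge0.
rewrite /W_norm2E tE.
apply: (@le_lt_trans _ _ ((2 * B * sumZ (fun x => t x ^+ 2))%:E + (sumZ (fun x => t x ^+ 2))%:E)%E).
  by rewrite leeD2r// (grad_norm2E_le _ _ wB).
move: Hsm; have -> : (fun x => if x \in s then 0 else u x ^+ 2) = (fun x => t x ^+ 2).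
  by apply/funext => x; rewrite /t; case: ifP; rewrite ?expr0n.
rewrite tE -EFinD !lte_fin ltr_pdivlMr; last by lra.
by lra.
Qed.

Lemma H_norm2E u : Hs u -> H_norm2 w a h u = a * G u + V u.
Proof.
move=> su; have lu := finite_potential_l2 u su.
rewrite /H_norm2 sumZD//; last first.
  by apply: abs_summableZ; apply: (grad_prod_summable _ _ wB).
by rewrite sumZZ -(grad_norm2_sumZ _ _ wB).
Qed.

Lemma JE u : Hs u -> J w a b p h u =
  2^-1 * (a * G u + V u) + b / 4 * G u ^+ 2 + 2 / p ^+ 2 * P u - p^-1 * L u.
Proof. by move=> su; rewrite /J H_norm2E. Qed.

Definition Nehari_fun u := a * G u + V u + b * G u ^+ 2 - L u.

Lemma dJE u phi : Hs u -> Hs phi -> dJ w a b p h u phi =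
  (a + b * G u) * grad_form w u phi + sumZ (fun x => h x * u x * phi x)
  - sumZ (fun x => nonlin p (u x) * phi x).
Proof.
move=> su sphi; have lu := finite_potential_l2 u su.
have lphi := finite_potential_l2 phi sphi.
rewrite /dJ sumZD; last 2 first.
- by apply: abs_summableZ; apply: (grad_prod_summable _ _ wB).
- exact: potential_summable.
rewrite (sumZZ a (grad_prod w u phi)) -/(G u).
rewrite (_ : sumZ (fun x => grad_prod w u phi x) = grad_form w u phi)//.
by rewrite -/(grad_form w u phi); ring.
Qed.

Lemma dJ_self u : Hs u -> dJ w a b p h u u = Nehari_fun u.
Proof.
move=> su; have lu := finite_potential_l2 u su.
rewrite dJE// /Nehari_fun /grad_form -(grad_norm2_sumZ _ _ wB)// -/(G u).
have -> : sumZ (fun x => nonlin p (u x) * u x) = L u.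
  by apply: eq_sumZ => x; rewrite nonlinM.
have -> : sumZ (fun x => h x * u x * u x) = V u by apply: eq_sumZ => x; ring.
ring.
Qed.

(** The functional [Phi]: subtracting [p^-1 * Nehari_fun u] from the energy eliminates the
    logarithmic sum, and [4 < p] makes all coefficients positive. *)
Definition reduced_energy u :=
  (2^-1 - p^-1) * (a * G u + V u) + b * (4^-1 - p^-1) * G u ^+ 2 + 2 / p ^+ 2 * P u.

Lemma J_reduced u : Hs u ->
  J w a b p h u = reduced_energy u + p^-1 * Nehari_fun u.
Proof. by move=> su; rewrite JE// /reduced_energy /Nehari_fun; ring. Qed.

Lemma grad_part_ge0 u : Hs u -> 0 <= G u.
Proof. by move=> su; apply: grad_norm2_ge0 wB _ _; exact: finite_potential_l2. Qed.

Lemma potential_part_ge0 u : 0 <= V u.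
Proof. exact: sumZ_ge0. Qed.

Lemma power_part_ge0 u : 0 <= P u.
Proof. by apply: sumZ_ge0 => x; exact: abs_pow_ge0. Qed.

Lemma potential_part_gt0 u x : Hs u -> u x != 0 -> 0 < V u.
Proof.
move=> su ux; apply: lt_le_trans (potential_sq_le u x su).
have u2 : 0 < u x ^+ 2 by rewrite exprn_even_gt0.
exact: mulr_gt0 (lt_le_trans h00 (hh x)) u2.
Qed.

Lemma grad_partZ c u : Hs u -> G (fun x => c * u x) = c ^+ 2 * G u.
Proof. by move=> su; apply: (grad_norm2Z _ _ wB); exact: finite_potential_l2. Qed.

Lemma potential_partZ c u : V (fun x => c * u x) = c ^+ 2 * V u.
Proof. by rewrite -sumZZ; apply: eq_sumZ => x; ring. Qed.

Lemma power_partZ c u : 0 < c -> P (fun x => c * u x) = c `^ p * P u.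
Proof. by move=> c0; rewrite -sumZZ; apply: eq_sumZ => x; exact: abs_powZ. Qed.

Lemma log_partZ c u : 0 < c -> Hs u ->
  L (fun x => c * u x) = c `^ p * (L u + ln (c ^+ 2) * P u).
Proof.
move=> c0 su; rewrite -[ln _ * _]sumZZ -sumZD ?abs_pow_ln_summable//; last first.
  by apply: abs_summableZ; exact: abs_pow_summable.
by rewrite -sumZZ; apply: eq_sumZ => x; exact: abs_pow_lnZ.
Qed.

Lemma Nehari_funZ c u : 0 < c -> Hs u -> Nehari_fun (fun x => c * u x) =
  ray p (a * G u + V u) (b * G u ^+ 2) (P u) (L u) c.
Proof. by move=> c0 su; rewrite /Nehari_fun grad_partZ// potential_partZ log_partZ// /ray; ring. Qed.

(** Where |u| <= 1 the logarithm is nonpositive, so the only term with a minus sign helps, and the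
    potential part is positive. *)
Lemma Nehari_fun_gt0 u x : Hs u -> (forall y, `|u y| <= 1) -> u x != 0 ->
  0 < Nehari_fun u.
Proof.
move=> su u1 ux; rewrite /Nehari_fun.
have L0 : L u <= 0.
  rewrite -oppr_ge0 -sumZN; apply: sumZ_ge0 => y.
  by rewrite oppr_ge0 abs_pow_ln_le0.
have := potential_part_gt0 u x su ux; have := mulr_ge0 (ltW a0) (grad_part_ge0 u su).
have := mulr_ge0 (ltW b0) (sqr_ge0 (G u)); lra.
Qed.

(** Scaling by the inverse of the sup bound brings |u| below 1, where [Nehari_fun] is positive. At
    [t = 1] it is nonpositive, and the intermediate value theorem applies in between. *)
Lemma Nehari_root u x : Hs u -> u x != 0 -> Nehari_fun u <= 0 ->
  exists2 t, 0 < t <= 1 & Nehari_fun (fun y => t * u y) = 0.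
Proof.
move=> su ux Iu.
have M0 : 0 <= V u / h0 by rewrite divr_ge0 ?potential_part_ge0// ltW.
have M1 : 0 < bnd (V u) by rewrite /bnd; lra.
have t0 : 0 < (bnd (V u))^-1 by rewrite invr_gt0.
have t1 : (bnd (V u))^-1 <= 1 by rewrite invf_le1// /bnd; lra.
have [||t /andP[tt0 tt1] E] := @ray_root _ p (a * G u + V u) (b * G u ^+ 2)
    (P u) (L u) (bnd (V u))^-1 1 t0 t1.
- rewrite -Nehari_funZ//; apply/ltW/(@Nehari_fun_gt0 _ x).
  + exact: finite_potentialZ.
  + move=> y; rewrite normrM gtr0_norm// mulrC ler_pdivrMr// mul1r.
    by apply: potential_bound.
  + by rewrite mulf_neq0// gt_eqF.
- rewrite -Nehari_funZ//; under [X in Nehari_fun X]eq_fun do rewrite mul1r.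
  exact: Iu.
exists t; first by rewrite tt1 (lt_le_trans t0).
by rewrite Nehari_funZ// (lt_le_trans t0).
Qed.

Lemma reduced_energyZ_le t u : 0 < t <= 1 -> Hs u ->
  reduced_energy (fun x => t * u x) <= reduced_energy u.
Proof.
move=> /andP[t0 t1] su; rewrite /reduced_energy grad_partZ// potential_partZ power_partZ//.
have t2 : t ^+ 2 <= 1 by rewrite exprn_ile1// ltW.
have t4 : (t ^+ 2) ^+ 2 <= 1 by rewrite exprn_ile1// ?sqr_ge0.
have tp : t `^ p <= 1.
  by rewrite -[leRHS](powRr0 t) ger_powR ?t0// ltW.
have pV : p^-1 < 4^-1 by rewrite ltf_pV2 ?posrE.
have c1 : 0 <= 2^-1 - p^-1 by lra.
have c2 : 0 <= b * (4^-1 - p^-1) by rewrite mulr_ge0 ?(ltW b0)//; lra.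
have c3 : 0 <= 2 / p ^+ 2 by rewrite divr_ge0// sqr_ge0.
apply: lerD; first apply: lerD.
- rewrite ler_wpM2l//.
  have A0 : 0 <= a * G u + V u by rewrite addr_ge0 ?potential_part_ge0// mulr_ge0 ?(ltW a0)// grad_part_ge0.
  have -> : a * (t ^+ 2 * G u) + t ^+ 2 * V u = t ^+ 2 * (a * G u + V u) by ring.
  by rewrite ler_piMl.
- by rewrite ler_wpM2l// exprMn ler_piMl// sqr_ge0.
- by rewrite ler_wpM2l// ler_piMl// power_part_ge0.
Qed.

Lemma reduced_energy_ge u : Hs u ->
  [/\ (2^-1 - p^-1) * a * G u <= reduced_energy u,
      (2^-1 - p^-1) * V u <= reduced_energy u &
      2 / p ^+ 2 * P u <= reduced_energy u].
Proof.
move=> su; have pV : p^-1 < 4^-1 by rewrite ltf_pV2 ?posrE.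
have c1 : 0 <= 2^-1 - p^-1 by lra.
have c2 : 0 <= b * (4^-1 - p^-1) by rewrite mulr_ge0 ?(ltW b0)//; lra.
have c3 : 0 <= 2 / p ^+ 2 by rewrite divr_ge0// sqr_ge0.
have q1 := mulr_ge0 (mulr_ge0 c1 (ltW a0)) (grad_part_ge0 u su).
have q2 := mulr_ge0 c1 (potential_part_ge0 u).
have q3 := mulr_ge0 c2 (sqr_ge0 (G u)).
have q4 := mulr_ge0 c3 (power_part_ge0 u).
by rewrite /reduced_energy mulrDr mulrA; split; lra.
Qed.

Lemma Nehari_fun_nonempty : exists u,
  [/\ Hs u, exists x, u x != 0 & Nehari_fun u <= 0].
Proof.
pose e (x : Zd d) : R := if x == 0 then 1 else 0.
have se : Hs e.
  have := @abs_summable_supp1 R d 0 (h 0); congr (is_true (abs_summable _)).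
  apply/funext => x; rewrite /e; case: eqVneq => [->|_]; first by rewrite expr1n mulr1.
  by rewrite expr0n mulr0.
have Pe : P e = 1.
  rewrite -[RHS](@sumZ_supp1 R d 0 1); apply: eq_sumZ => x; rewrite /e.
  by case: ifP => _; rewrite ?abs_pow0// /abs_pow normr1 powR1.
have Le : L e = 0.
  rewrite -[RHS](@sumZ0 R d); apply: eq_sumZ => x; rewrite /e.
  by case: ifP => _; rewrite ?abs_pow_ln0// /abs_pow_ln expr1n ln1 mulr0.
set A := a * G e + V e; set C := b * G e ^+ 2.
have A0 : 0 <= A by rewrite addr_ge0 ?potential_part_ge0// mulr_ge0 ?(ltW a0)// grad_part_ge0.
have C0 : 0 <= C by rewrite mulr_ge0 ?(ltW b0)// sqr_ge0.
(* For this [T], ln(T^2) = 2 (A + C), while T^2 <= T^4 <= T^p. The logarithmic term T^p ln(T^2)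
   therefore dominates T^2 A + T^4 C. *)
pose T := expR (A + C).
have T0 : 0 < T by exact: expR_gt0.
have T1 : 1 <= T by rewrite /T -expR0 ler_expR addr_ge0.
exists (fun x => T * e x); split.
- exact: finite_potentialZ.
- by exists 0; rewrite /e eqxx mulr1 gt_eqF.
rewrite Nehari_funZ// -/A -/C Pe Le /ray add0r mulr1 lnXn// expRK.
have T24 : T ^+ 2 <= T ^+ 4 by rewrite ler_weXn2l.
have T4p : T ^+ 4 <= T `^ p.
  by rewrite -powR_mulrn ?(ltW T0)// ler_powR// ltW.
have Tp := powR_ge0 T p.
have H1 := ler_wpM2r A0 (le_trans T24 T4p); have H2 := ler_wpM2r C0 T4p.
have H3 := mulr_ge0 Tp A0; have H4 := mulr_ge0 Tp C0.
move: (T `^ p) H1 H2 H3 H4 => q; rewrite mulr2n; nra.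
Qed.

(** * Existence of a minimiser of the reduced energy *)

Hypothesis h_coercive : forall M, exists s : seq (Zd d), forall x, x \notin s -> M < h x.

Lemma exists_minimizer : exists u,
  [/\ Hs u, exists x, u x != 0, Nehari_fun u <= 0 &
   forall v, Hs v -> (exists x, v x != 0) -> Nehari_fun v <= 0 ->
     reduced_energy u <= reduced_energy v].
Proof.
pose S := [set v | [/\ Hs v, exists x, v x != 0 & Nehari_fun v <= 0]].
pose E := reduced_energy @` S.
have E0 : has_inf E.
  split; first by have [v Sv] := Nehari_fun_nonempty; exists (reduced_energy v), v.
  exists 0 => _ [v [sv _ _] <-]; have [_ H _] := reduced_energy_ge v sv.
  apply: le_trans H; rewrite mulr_ge0 ?potential_part_ge0// subr_ge0 lef_pV2 ?posrE//.
  by have := p4; lra.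
set m := inf E.
have /choice[v Hv] n : exists v, S v /\ reduced_energy v < m + n.+1%:R^-1.
  have [|_ [v Sv <-] vm] := @inf_adherent _ E n.+1%:R^-1 _ E0.
    by rewrite invr_gt0.
  by exists v.
have sv n : Hs (v n) by case: (Hv n) => -[].
have vm1 n : reduced_energy (v n) <= m + 1.
  case: (Hv n) => _ /ltW H; apply: le_trans H _; rewrite lerD2l.
  by rewrite invf_le1// ler1n.
have pV : p^-1 < 4^-1 by rewrite ltf_pV2 ?posrE.
have c1 : 0 < 2^-1 - p^-1 by lra.
have c2 : 0 <= b * (4^-1 - p^-1) by rewrite mulr_ge0 ?(ltW b0)//; lra.
have c3 : 0 < 2 / p ^+ 2 by rewrite divr_gt0// exprn_gt0.
(* Bounds on the three parts along the sequence, read off from [reduced_energy_ge] at the level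
   [m + 1]. *)
pose MG := (m + 1) / ((2^-1 - p^-1) * a).
pose MV := (m + 1) / (2^-1 - p^-1).
pose MP := (m + 1) / (2 / p ^+ 2).
have bV n : V (v n) <= MV.
  have [_ H _] := reduced_energy_ge _ (sv n).
  by rewrite ler_pdivlMr// mulrC (le_trans H).
have bG n : G (v n) <= MG.
  have [H _ _] := reduced_energy_ge _ (sv n).
  by rewrite ler_pdivlMr ?mulr_gt0// mulrC (le_trans H).
have bP n : P (v n) <= MP.
  have [_ _ H] := reduced_energy_ge _ (sv n).
  by rewrite ler_pdivlMr// mulrC (le_trans H).
set K := bnd MV `^ p + bnd MV `^ (p - 4).
have K0 : 0 <= K by rewrite addr_ge0 ?powR_ge0.
have sqV n x : (v n x) ^+ 2 <= MV / h0.
  rewrite ler_pdivlMr// mulrC; apply: le_trans (bV n).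
  by apply: le_trans (potential_sq_le _ x (sv n)); rewrite ler_wpM2r ?sqr_ge0.
have blw n x : `|abs_pow_ln p (v n x)| <= K * (MV / h0).
  by apply: le_trans (norm_abs_pow_ln_le _ MV x (sv n) (bV n)) _; rewrite ler_wpM2l.
have bL n : `|L (v n)| <= K * (MV / h0).
  apply: le_trans (norm_sumZ _ (abs_pow_ln_summable _ (sv n))) _.
  apply: (@le_trans _ _ (sumZ (fun x => K * h0^-1 * (h x * v n x ^+ 2)))).
    apply: le_sumZ; first exact/abs_summable_norm/abs_pow_ln_summable.
      by apply: abs_summableZ; exact: sv.
    move=> x; apply: le_trans (norm_abs_pow_ln_le _ MV x (sv n) (bV n)) _.
    rewrite -mulrA ler_wpM2l// mulrA ler_peMl ?sqr_ge0//.
    by rewrite mulrC ler_pdivlMr// mul1r.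
  by rewrite sumZZ -mulrA ler_wpM2l// mulrC ler_wpM2r ?bV// invr_ge0 ltW.
(* Along one ultrafilter finer than [\oo] all bounded sequences converge at once: the values at
   every site and the four parts of the energy. *)
have [U [UU ooU]] := ultraFilterLemma (_ : ProperFilter \oo).
have /choice[u vu] x : exists l : R, (fun n => v n x) @ U --> l.
  apply: (@ultra_bounded_cvg _ _ _ _ (bnd MV)) => n.
  exact: potential_bound.
have [g vg] : exists l : R, (fun n => G (v n)) @ U --> l.
  by apply: (@ultra_bounded_cvg _ _ _ _ MG) => n; rewrite ger0_norm// grad_part_ge0.
have [be vbe] : exists l : R, (fun n => V (v n)) @ U --> l.
  by apply: (@ultra_bounded_cvg _ _ _ _ MV) => n; rewrite ger0_norm// potential_part_ge0.
have [pp vpp] : exists l : R, (fun n => P (v n)) @ U --> l.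
  by apply: (@ultra_bounded_cvg _ _ _ _ MP) => n; rewrite ger0_norm// power_part_ge0.
have [el vel] : exists l : R, (fun n => L (v n)) @ U --> l.
  by apply: (@ultra_bounded_cvg _ _ _ _ (K * (MV / h0))).
have [su uV] : Hs u /\ V u <= be.
  apply: (@sumZ_fatou _ _ _ U _ (fun n x => h x * v n x ^+ 2)) => // x.
  apply: cvgMr; under eq_fun do rewrite expr2.
  by rewrite expr2; apply: cvgM; exact: vu.
have uG : G u <= g.
  apply: (@grad_norm2_fatou _ _ w B wB _ U _ v) => // [n|];
    exact: finite_potential_l2.
have uP : P u <= pp.
  have [||||//] := @sumZ_fatou _ _ _ U _ (fun n x => abs_pow p (v n x)) (fun x => abs_pow p (u x)) pp.
  - by move=> n x; exact: abs_pow_ge0.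
  - by move=> n; exact: abs_pow_summable.
  - by move=> x; apply: continuous_cvg; [exact: abs_pow_continuous|exact: vu].
  - exact: vpp.
have [s0 Hs0] := h_coercive MV.
(* Off [s0], [h x * v n x ^+ 2 <= MV < h x]. *)
have out n x : x \notin s0 -> `|v n x| <= 1.
  move=> /Hs0 hx; rewrite -(@expr_le1 _ 2)// real_normK ?num_real//.
  have hx0 : 0 < h x by exact: lt_le_trans h00 (hh x).
  rewrite -(ler_pM2l hx0) mulr1; apply: le_trans (ltW hx).
  exact: le_trans (potential_sq_le _ x (sv n)) (bV n).
pose c := K * (MV / h0).
pose ind (x : Zd d) : R := if x \in s0 then c else 0.
have sind : abs_summable ind by exact: abs_summable_finsupp.
(* The constant [c] on [s0] makes the summand nonnegative, so that Fatou applies. *)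
have uL : el <= L u.
  have [||||_] := @sumZ_fatou _ _ _ U _ (fun n x => ind x - abs_pow_ln p (v n x))
      (fun x => ind x - abs_pow_ln p (u x)) (sumZ ind - el).
  - move=> n x; rewrite subr_ge0 /ind; case: ifPn => [_|/out/abs_pow_ln_le0]; last exact.
    exact: le_trans (ler_norm _) (blw n x).
  - by move=> n; apply: abs_summableB => //; exact: abs_pow_ln_summable.
  - move=> x; apply: cvgB; first exact: cvg_cst.
    by apply: continuous_cvg; [exact: abs_pow_ln_continuous|exact: vu].
  - under eq_fun do rewrite sumZB ?abs_pow_ln_summable//.
    by apply: cvgB => //; exact: cvg_cst.
  by rewrite sumZB ?abs_pow_ln_summable// -/(L u); lra.
have un0 : exists x, u x != 0.
  have cs : (fun n => \sum_(x <- s0) (v n x) ^+ 2) @ U --> \sum_(x <- s0) (u x) ^+ 2.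
    elim: s0 {Hs0 out ind sind uL} => [|x s IH].
      by rewrite big_nil; under eq_fun do rewrite big_nil; exact: cvg_cst.
    rewrite big_cons; under eq_fun do rewrite big_cons.
    apply: cvgD => //; rewrite expr2; under eq_fun do rewrite expr2.
    by apply: cvgM; exact: vu.
  (* If such a sum for [v n] were below 1, then |v n| <= 1 on [s0] as well as off it, and
     [Nehari_fun_gt0] would contradict the constraint. The bound survives in the limit because [s0]
     is finite. *)
  have : 1 <= \sum_(x <- s0) (u x) ^+ 2.
    apply: (cvgr_to_ge cs); apply: filterE => n.
    have [[_ [z vz] In] _] := Hv n.
    have [//|/negP nl1] := boolP (1 <= \sum_(x <- s0) v n x ^+ 2).
    exfalso; suff : 0 < Nehari_fun (v n) by move: In; lra.
    apply: (@Nehari_fun_gt0 _ z) => // x.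
    have [/out//|/negPn xs] := boolP (x \notin s0).
    rewrite -(@expr_le1 _ 2)// real_normK ?num_real//.
    move/negP: nl1; rewrite -ltNge => /ltW; apply: le_trans.
    rewrite (big_rem x xs)/= lerDl sumr_ge0// => y _; exact: sqr_ge0.
  apply: contraPP => /forallNP H; apply/negP; rewrite -ltNge.
  rewrite big1 ?ltr01// => x _.
  by have /negP := H x; rewrite negbK => /eqP ->; rewrite expr0n.
(* The constraint is lower semicontinuous: the limit of [Nehari_fun (v n)] is nonpositive and
   dominates [Nehari_fun u] by [uG], [uV] and [uL]. *)
exists u; split => //.
  have cI : (fun n => Nehari_fun (v n)) @ U --> a * g + be + b * g ^+ 2 - el.
    apply: cvgB => //; apply: cvgD; first by apply: cvgD => //; exact: cvgMr.
    apply: cvgMr; rewrite expr2; under eq_fun do rewrite expr2.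
    exact: cvgM.
  have : a * g + be + b * g ^+ 2 - el <= 0.
    by apply: (cvgr_to_le cI); apply: filterE => n; case: (Hv n) => -[].
  apply: le_trans; rewrite /Nehari_fun; apply: lerB => //.
  apply: lerD; first by apply: lerD => //; rewrite ler_pM2l.
  rewrite ler_pM2l// lerXn2r ?nnegrE ?grad_part_ge0//.
  exact: le_trans (grad_part_ge0 _ su) uG.
move=> v' sv' nv' Iv'.
apply: (@le_trans _ _ m); last by apply: ge_inf; [exact: E0.2|exists v'].
pose lim_red := (2^-1 - p^-1) * (a * g + be) + b * (4^-1 - p^-1) * g ^+ 2 + 2 / p ^+ 2 * pp.
have cR : (fun n => reduced_energy (v n)) @ U --> lim_red.
  apply: cvgD; last exact: cvgMr.
  apply: cvgD; first by apply: cvgMr; apply: cvgD => //; exact: cvgMr.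
  apply: cvgMr; rewrite expr2; under eq_fun do rewrite expr2.
  exact: cvgM.
apply: (@le_trans _ _ lim_red).
  apply: lerD; last by rewrite ler_pM2l.
  apply: lerD; first by rewrite ler_pM2l// lerD// ler_pM2l.
  rewrite ler_wpM2l// lerXn2r ?nnegrE ?grad_part_ge0//.
  exact: le_trans (grad_part_ge0 _ su) uG.
(* The limit of the reduced energies is at most [m], since they eventually stay below [m + e] and
   [U] refines [\oo]. *)
apply/ler_addgt0Pr => e e0; apply: (cvgr_to_le cR).
have : \forall n \near \oo, reduced_energy (v n) <= m + e.
  near=> n; case: (Hv n) => _ /ltW H; apply: le_trans H _; rewrite lerD2l.
  by apply: ltW; near: n; exact: (near_infty_natSinv_lt (PosNum e0)).
exact: ooU.
Unshelve. all: by end_near. Qed.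

(** * Criticality of the minimiser *)

Definition site (z x : Zd d) : R := if x == z then 1 else 0.

Lemma site_finite_potential z : Hs (site z).
Proof.
have := @abs_summable_supp1 R d z (h z); congr (is_true (abs_summable _)).
apply/funext => x; rewrite /site; case: eqVneq => [->|_].
  by rewrite expr1n mulr1.
by rewrite expr0n mulr0.
Qed.

Lemma dJ_site u z : Hs u -> dJ w a b p h u (site z) =
  (a + b * G u) * grad_form w u (site z) + h z * u z - nonlin p (u z).
Proof.
move=> su; rewrite dJE//; last exact: site_finite_potential.
have S1 (f : Zd d -> R) : sumZ (fun x => f x * site z x) = f z.
  rewrite -[RHS](@sumZ_supp1 R d z); apply: eq_sumZ => x; rewrite /site.
  by case: eqVneq => [->|_]; rewrite ?mulr1 ?mulr0.
by rewrite !S1.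
Qed.

Lemma dJD u phi psi : Hs u -> Hs phi -> Hs psi ->
  dJ w a b p h u (fun x => phi x + psi x) = dJ w a b p h u phi + dJ w a b p h u psi.
Proof.
move=> su s1 s2; rewrite !dJE//; last exact: finite_potentialD.
rewrite (grad_formD _ _ wB); do ?exact: finite_potential_l2.
have -> : sumZ (fun x => h x * u x * (phi x + psi x)) =
    sumZ (fun x => h x * u x * phi x) + sumZ (fun x => h x * u x * psi x).
  rewrite -sumZD; do ?exact: potential_summable.
  by apply: eq_sumZ => x; ring.
have -> : sumZ (fun x => nonlin p (u x) * (phi x + psi x)) =
    sumZ (fun x => nonlin p (u x) * phi x) + sumZ (fun x => nonlin p (u x) * psi x).
  rewrite -sumZD; do ?exact: nonlin_summable.
  by apply: eq_sumZ => x; ring.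
ring.
Qed.

Lemma dJZ u phi c : Hs u -> Hs phi ->
  dJ w a b p h u (fun x => c * phi x) = c * dJ w a b p h u phi.
Proof.
move=> su s1; rewrite !dJE//; last exact: finite_potentialZ.
rewrite grad_formZ.
have -> : sumZ (fun x => h x * u x * (c * phi x)) = c * sumZ (fun x => h x * u x * phi x).
  by rewrite -sumZZ; apply: eq_sumZ => x; ring.
have -> : sumZ (fun x => nonlin p (u x) * (c * phi x)) =
    c * sumZ (fun x => nonlin p (u x) * phi x).
  by rewrite -sumZZ; apply: eq_sumZ => x; ring.
ring.
Qed.

(** Expand the nonnegative quantities [G (u + v)] and [G (u - v)]. *)
Lemma norm_grad_form_le u v : Hs u -> Hs v -> `|grad_form w u v| <= G u + G v.
Proof.
move=> su sv; have lu := finite_potential_l2 _ su; have lv := finite_potential_l2 _ sv.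
have H c : 0 <= G u + 2 * c * grad_form w u v + c ^+ 2 * G v.
  rewrite -(grad_norm2D _ _ wB)//; apply: grad_part_ge0.
  by apply: finite_potentialD => //; exact: finite_potentialZ.
have := H 1; have := H (-1); rewrite sqrrN expr1n => H1 H2.
have := grad_part_ge0 _ su; have := grad_part_ge0 _ sv.
by rewrite ler_norml => ? ?; apply/andP; split; lra.
Qed.

Lemma l2_le_potential u : Hs u -> sumZ (fun x => u x ^+ 2) <= h0^-1 * V u.
Proof.
move=> su; rewrite -sumZZ; apply: le_sumZ; first exact: finite_potential_l2.
  exact: abs_summableZ.
move=> x; rewrite mulrA ler_peMl ?sqr_ge0//.
by rewrite mulrC ler_pdivlMr// mul1r.
Qed.

(** Products are estimated by sums of squares, so the bound is affine in [V phi]. Linearity of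
    [dJ u] later upgrades it by scaling [phi]. *)
Lemma dJ_bounded u : Hs u -> exists K0 K1 : R, [/\ 0 <= K0, 0 <= K1 &
  forall phi, Hs phi -> `|dJ w a b p h u phi| <= K0 + K1 * V phi].
Proof.
move=> su; set c := bnd (V u) `^ p + bnd (V u) `^ (p - 4).
have c0 : 0 <= c by rewrite addr_ge0 ?powR_ge0.
have k0 : 0 <= a + b * G u by rewrite addr_ge0 ?(ltW a0)// mulr_ge0 ?(ltW b0)// grad_part_ge0.
have B0 := summable_weight_ge0 _ _ wB.
have hV : 0 <= h0^-1 by rewrite invr_ge0 ltW.
set k := a + b * G u in k0 *.
exists (k * G u + V u + c * sumZ (fun x => u x ^+ 2)), (k * (2 * B * h0^-1) + 1 + c * h0^-1).
have l2u : 0 <= sumZ (fun x => u x ^+ 2) by apply: sumZ_ge0 => x; exact: sqr_ge0.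
split.
- exact: addr_ge0 (addr_ge0 (mulr_ge0 k0 (grad_part_ge0 _ su)) (potential_part_ge0 _)) (mulr_ge0 c0 l2u).
- have B2 : 0 <= 2 * B by rewrite mulr_ge0.
  exact: addr_ge0 (addr_ge0 (mulr_ge0 k0 (mulr_ge0 B2 hV)) ler01) (mulr_ge0 c0 hV).
move=> phi sphi; rewrite dJE// -/k.
have GB : G phi <= 2 * B * (h0^-1 * V phi).
  apply: le_trans (grad_norm2_le _ _ wB _ (finite_potential_l2 _ sphi)) _.
  by rewrite ler_wpM2l ?mulr_ge0// l2_le_potential.
have E1 : `|k * grad_form w u phi| <= k * (G u + 2 * B * (h0^-1 * V phi)).
  rewrite normrM ger0_norm// ler_wpM2l//.
  by apply: le_trans (norm_grad_form_le _ _ su sphi) _; rewrite lerD2l.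
have E2 : `|sumZ (fun x => h x * u x * phi x)| <= V u + V phi.
  have sp := potential_summable _ _ su sphi.
  apply: le_trans (norm_sumZ _ sp) _; rewrite -sumZD//.
  apply: le_sumZ; [exact: abs_summable_norm|exact: abs_summableD|move=> x].
  rewrite !normrM ger0_norm// -mulrA -mulrDr ler_wpM2l//.
  rewrite -[u x ^+ 2]real_normK ?num_real// -[phi x ^+ 2]real_normK ?num_real//.
  have := sqr_ge0 (`|u x| - `|phi x|); have := sqr_ge0 (`|u x| + `|phi x|); nra.
have E3 : `|sumZ (fun x => nonlin p (u x) * phi x)| <=
    c * (sumZ (fun x => u x ^+ 2) + h0^-1 * V phi).
  have sp := nonlin_summable _ _ su sphi.
  have l1 := finite_potential_l2 _ su; have l2 := finite_potential_l2 _ sphi.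
  apply: le_trans (norm_sumZ _ sp) _.
  apply: (@le_trans _ _ (c * (sumZ (fun x => u x ^+ 2) + sumZ (fun x => phi x ^+ 2)))); last first.
    by rewrite ler_wpM2l// lerD2l l2_le_potential.
  rewrite -sumZD// -sumZZ; apply: le_sumZ; first exact: abs_summable_norm.
    by apply: abs_summableZ; exact: abs_summableD.
  move=> x; rewrite normrM; apply: (@le_trans _ _ (c * `|u x| * `|phi x|)).
    by rewrite ler_wpM2r// norm_nonlin_le// potential_bound.
  rewrite -mulrA ler_wpM2l// -[u x ^+ 2]real_normK ?num_real// -[phi x ^+ 2]real_normK ?num_real//.
  have := sqr_ge0 (`|u x| - `|phi x|); have := sqr_ge0 (`|u x| + `|phi x|); nra.
apply: le_trans (ler_normB _ _) _.
have := ler_normD (k * grad_form w u phi) (sumZ (fun x => h x * u x * phi x)) => E4.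
apply: le_trans (lerD (le_trans E4 (lerD E1 E2)) E3) _.
by rewrite le_eqVlt; apply/orP; left; apply/eqP; ring.
Qed.

(** By linearity [dJ u] vanishes on finitely supported functions; the remaining tail of [phi] is
    small in the potential norm, where [dJ u] is bounded. *)
Lemma critical_of_sites u : Hs u -> (forall z, dJ w a b p h u (site z) = 0) ->
  forall phi, Hs phi -> dJ w a b p h u phi = 0.
Proof.
move=> su Hsite phi sphi.
have [K0 [K1 [K00 K10 HK]]] := dJ_bounded _ su.
have trunc (s : seq (Zd d)) : dJ w a b p h u (fun x => if x \in s then phi x else 0) = 0.
  elim: s => [|z s IH].
    rewrite (_ : (fun _ => _) = (fun x => 0 * phi x)) ?dJZ ?mul0r//.
    by apply/funext => x; rewrite mul0r.
  (* The list may contain repetitions; a site already present must not be added twice. *)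
  pose c := if z \in s then 0 else phi z.
  rewrite (_ : (fun _ => _) = (fun x => (if x \in s then phi x else 0) + c * site z x)).
    rewrite dJD//.
    - by rewrite IH dJZ ?Hsite ?mulr0 ?addr0//; exact: site_finite_potential.
    - apply: finite_potential_le sphi => x.
      by case: ifP; rewrite ?normr0.
    - by apply: finite_potentialZ; exact: site_finite_potential.
  apply/funext => x; rewrite inE /site /c; case: eqVneq => [->|_] /=.
    by case: ifP; rewrite mulr1 ?addr0 ?add0r.
  by rewrite mulr0 addr0.
have small e : 0 < e -> `|dJ w a b p h u phi| <= e * (K0 + K1).
  move=> e0.
  have [|s Hsm] := @sumZ_tail _ _ (fun x => h x * phi x ^+ 2) (e ^+ 2) (hu_ge0 _) sphi.
    exact: exprn_gt0.
  pose t x := if x \in s then 0 else phi x.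
  have st : Hs t.
    by apply: finite_potential_le sphi => x; rewrite /t; case: ifP; rewrite ?normr0.
  have Vt : V t <= e ^+ 2.
    rewrite -lee_fin ge0_esumZK//; apply: le_trans (ltW Hsm).
    apply: le_esum => x _; rewrite lee_fin /t; case: ifP => //.
    by rewrite expr0n mulr0.
  have -> : dJ w a b p h u phi = dJ w a b p h u t.
    rewrite -[RHS]add0r -(trunc s) -dJD//.
      congr (dJ _ _ _ _ _ _ _); apply/funext => x; rewrite /t.
      by case: ifP; rewrite ?addr0 ?add0r.
    by apply: finite_potential_le sphi => x; case: ifP; rewrite ?normr0.
  (* Rescaling the tail by [e^-1] gives potential energy at most 1, so the affine bound becomes
     [e * (K0 + K1)]. *)
  have := HK _ (finite_potentialZ e^-1 _ st).
  rewrite dJZ// potential_partZ normrM gtr0_norm ?invr_gt0// ler_pdivrMl// => H.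
  apply: le_trans H _; rewrite ler_pM2l// lerD2l ler_piMr//.
  by rewrite exprVn mulrC ler_pdivrMr ?exprn_gt0// mul1r.
apply/eqP; rewrite -normr_le0; apply/ler_addgt0Pl => e e0.
have D0 : 0 < K0 + K1 + 1 by lra.
have := small (e / (K0 + K1 + 1)) (divr_gt0 e0 D0); rewrite addr0 => H.
apply: le_trans H _; rewrite mulrAC ler_pdivrMr// ler_pM2l//; lra.
Qed.

Lemma JZ t u : 0 < t -> Hs u -> J w a b p h (fun x => t * u x) =
  t ^+ 2 / 2 * (a * G u + V u) + t ^+ 4 / 4 * (b * G u ^+ 2)
  + t `^ p * (2 / p ^+ 2 * P u - p^-1 * (L u + ln (t ^+ 2) * P u)).
Proof.
move=> t0 su; rewrite JE; last exact: finite_potentialZ.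
by rewrite grad_partZ// potential_partZ power_partZ// log_partZ//; field; rewrite gt_eqF.
Qed.

(* The two polynomial parts are compared by Bernoulli's inequality, the logarithmic
   one by [x - 1 <= x ln x] at [x = t `^ p]. *)
Lemma J_ray_le_Nehari t u : 0 < t -> Hs u -> Nehari_fun u = 0 ->
  J w a b p h (fun x => t * u x) <= J w a b p h u.
Proof.
move=> t0 su Iu; rewrite JZ// JE//.
set A := a * G u + V u; set C := b * G u ^+ 2.
have A0 : 0 <= A by rewrite addr_ge0 ?potential_part_ge0// mulr_ge0 ?(ltW a0)// grad_part_ge0.
have C0 : 0 <= C by rewrite mulr_ge0 ?(ltW b0)// sqr_ge0.
have -> : L u = A + C by move: Iu; rewrite /Nehari_fun -/A -/C; lra.
(* All powers and logarithms of the non-polynomial part are expressed through one variable, the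
   [p]-th power of [t]. *)
have lnt : ln (t ^+ 2) = 2 / p * ln (t `^ p).
  by rewrite lnXn// ln_powR; field; rewrite gt_eqF.
have n2 : 2 < p by have := p4; lra.
have H2 := ler_wpM2l A0 (expr_powR_le p p4 2 t isT n2 t0).
have H4 := ler_wpM2l C0 (expr_powR_le p p4 4 t isT p4 t0).
have s0 : 0 < t `^ p by rewrite powR_gt0.
have H3 := mulr_ge0 (power_part_ge0 u) (_ : 0 <= t `^ p * ln (t `^ p) - (t `^ p - 1)).
have {}H3 := H3 _; rewrite subr_ge0 in H3; have {}H3 := H3 (xlnx_ge _ s0).
have c3 : 0 <= 2 / p ^+ 2 by rewrite divr_ge0// sqr_ge0.
have {}H3 := mulr_ge0 c3 H3.
rewrite lnt -subr_ge0; move: (t `^ p) (ln _) H2 H3 H4 => s l H2 H3 H4.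
have -> : 2^-1 * A + b / 4 * G u ^+ 2 + 2 / p ^+ 2 * P u - p^-1 * (A + C) -
   (t ^+ 2 / 2 * A + t ^+ 4 / 4 * C + s * (2 / p ^+ 2 * P u - p^-1 * (A + C + 2 / p * l * P u)))
  = (A * ((1 - t ^+ 2) / 2) - A * ((1 - s) / p)) +
    (C * ((1 - t ^+ 4) / 4) - C * ((1 - s) / p)) +
    2 / p ^+ 2 * (P u * (s * l - (s - 1))).
  by rewrite /C; field; rewrite gt_eqF.
by rewrite addr_ge0// addr_ge0// subr_ge0.
Qed.

(** The value [A + C] of the logarithmic part puts [t = 1] on the Nehari manifold. The ray equals A
    (t^2 - t^p) + C (t^4 - t^p) - Q t^p ln(t^2), where each term changes sign at 1 and the first one
    strictly. *)
Lemma ray_signs A C Q t : 0 < A -> 0 <= C -> 0 <= Q -> 0 < t ->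
  (t < 1 -> 0 < ray p A C Q (A + C) t) /\ (1 < t -> ray p A C Q (A + C) t < 0).
Proof.
move=> A0 C0 Q0 t0.
have E : t `^ p = t ^+ 4 * t `^ (p - 4).
  rewrite -powR_mulrn ?(ltW t0)// -powRD ?(gt_eqF t0) ?implybT//.
  by congr (_ `^ _); lra.
have p40 : 0 <= p - 4 by have := p4; lra.
have t4 : 0 < t ^+ 4 by rewrite exprn_gt0.
have s0 : 0 < t `^ p by rewrite powR_gt0.
have E42 : t ^+ 4 = t ^+ 2 * t ^+ 2 by ring.
have t2 : 0 < t ^+ 2 by rewrite exprn_gt0.
split => t1; rewrite /ray.
  have s4 : t `^ p <= t ^+ 4.
    rewrite E -[leRHS]mulr1 ler_pM2l// -[leRHS](powRr0 t).
    by apply: ger_powR => //; rewrite t0 ltW.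
  have t21 : t ^+ 2 < 1 by rewrite exprn_ilt1// ltW.
  have t42 : t ^+ 4 < t ^+ 2 by rewrite E42 -[ltRHS]mulr1 ltr_pM2l.
  have ln0 : ln (t ^+ 2) <= 0 by rewrite ln_le0 ?ltW.
  have H1 : 0 < A * (t ^+ 2 - t `^ p) by rewrite mulr_gt0//; lra.
  have H2 : 0 <= C * (t ^+ 4 - t `^ p) by rewrite mulr_ge0//; lra.
  have H3 : 0 <= t `^ p * ((- ln (t ^+ 2)) * Q).
    by rewrite !mulr_ge0 ?(ltW s0)// oppr_ge0.
  lra.
have s4 : t ^+ 4 <= t `^ p.
  rewrite E -[leLHS]mulr1 ler_pM2l// -[leLHS](powRr0 t).
  by apply: ler_powR => //; exact: ltW.
have t21 : 1 < t ^+ 2 by rewrite exprn_egt1.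
have t42 : t ^+ 2 < t ^+ 4 by rewrite E42 -[ltLHS]mulr1 ltr_pM2l.
have ln0 : 0 <= ln (t ^+ 2) by rewrite ln_ge0 ?ltW.
have H1 : 0 < A * (t `^ p - t ^+ 2) by rewrite mulr_gt0//; lra.
have H2 : 0 <= C * (t `^ p - t ^+ 4) by rewrite mulr_ge0//; lra.
have H3 : 0 <= t `^ p * (ln (t ^+ 2) * Q) by rewrite !mulr_ge0 ?(ltW s0).
lra.
Qed.

(** * One-site perturbations *)

Section SitePerturbation.
Variables (u : Zd d -> R) (z : Zd d).
Hypothesis su : Hs u.

Let q := grad_form w u (site z).
Let Gd := G (site z).
Let us (r : R) x := u x + r * site z x.

Let us_z r : us r z = u z + r.
Proof. by rewrite /us /site eqxx mulr1. Qed.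

Let us_x r x : x != z -> us r x = u x.
Proof. by move=> xz; rewrite /us /site (negPf xz) mulr0 addr0. Qed.

Lemma perturb_finite_potential r : Hs (us r).
Proof. by apply: finite_potential_site su => x; exact: us_x. Qed.

Lemma perturb_grad r : G (us r) = G u + 2 * r * q + r ^+ 2 * Gd.
Proof.
apply: (grad_norm2D _ _ wB); apply: finite_potential_l2 => //.
exact: site_finite_potential.
Qed.

(** Here and for the power and logarithmic sums only the term at [z] changes. Derivatives in [r] are
    thus derivatives of functions of one real variable, with no exchange of limit and sum. *)
Lemma perturb_potential r : V (us r) = V u + h z * (2 * r * u z + r ^+ 2).
Proof.
rewrite /V (@sumZ_site _ _ z (fun x => h x * u x ^+ 2))//.
  by rewrite us_z; congr (_ + _); ring.
by move=> x xz; rewrite us_x.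
Qed.

Lemma perturb_power r : P (us r) = P u + (abs_pow p (u z + r) - abs_pow p (u z)).
Proof.
rewrite /P (@sumZ_site _ _ z (fun x => abs_pow p (u x))) ?us_z//; last exact: abs_pow_summable.
by move=> x xz; rewrite us_x.
Qed.

Lemma perturb_log r : L (us r) = L u + (abs_pow_ln p (u z + r) - abs_pow_ln p (u z)).
Proof.
rewrite /L (@sumZ_site _ _ z (fun x => abs_pow_ln p (u x))) ?us_z//; last exact: abs_pow_ln_summable.
by move=> x xz; rewrite us_x.
Qed.

Let id0 : (fun r : R => r) @ 0^' --> (0 : R). Proof. exact: cvg_within. Qed.

Let shift0 (f : R -> R) : continuous f -> (fun r => f (u z + r)) @ 0^' --> f (u z).
Proof.
move=> cf; apply: continuous_cvg; first exact: cf.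
apply: (@cvg_to_eq _ _ _ _ (u z + 0)); first by rewrite addr0.
by apply: cvgD; [exact: cvg_cst|exact: id0].
Qed.

Let cG : (fun r => G (us r)) @ 0^' --> G u.
Proof.
under eq_fun do rewrite perturb_grad.
apply: (@cvg_to_eq _ _ _ _ (G u + 2 * 0 * q + 0 * 0 * Gd)); first by ring.
under eq_fun do rewrite expr2.
apply: cvgD; first apply: cvgD; first exact: cvg_cst.
- by apply: cvgMl; apply: cvgMr; exact: id0.
- by apply: cvgMl; apply: cvgM; exact: id0.
Qed.

Let cV : (fun r => V (us r)) @ 0^' --> V u.
Proof.
under eq_fun do rewrite perturb_potential.
apply: (@cvg_to_eq _ _ _ _ (V u + h z * (2 * 0 * u z + 0 * 0))); first by ring.
under eq_fun do rewrite expr2.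
apply: cvgD; first exact: cvg_cst.
apply: cvgMr; apply: cvgD; first by apply: cvgMl; apply: cvgMr; exact: id0.
by apply: cvgM; exact: id0.
Qed.

Let cP : (fun r => P (us r)) @ 0^' --> P u.
Proof.
under eq_fun do rewrite perturb_power.
apply: (@cvg_to_eq _ _ _ _ (P u + (abs_pow p (u z) - abs_pow p (u z)))); first by ring.
apply: cvgD; first exact: cvg_cst.
by apply: cvgB; [apply: shift0; exact: abs_pow_continuous|exact: cvg_cst].
Qed.

Let cL : (fun r => L (us r)) @ 0^' --> L u.
Proof.
under eq_fun do rewrite perturb_log.
apply: (@cvg_to_eq _ _ _ _ (L u + (abs_pow_ln p (u z) - abs_pow_ln p (u z)))); first by ring.
apply: cvgD; first exact: cvg_cst.
by apply: cvgB; [apply: shift0; exact: abs_pow_ln_continuous|exact: cvg_cst].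
Qed.

Lemma perturb_ray_cvg t :
  (fun r => ray p (a * G (us r) + V (us r)) (b * G (us r) ^+ 2) (P (us r)) (L (us r)) t) @ 0^'
  --> ray p (a * G u + V u) (b * G u ^+ 2) (P u) (L u) t.
Proof.
rewrite /ray; apply: cvgB.
  apply: cvgD; apply: cvgMr.
    by apply: cvgD; [apply: cvgMr; exact: cG|exact: cV].
  apply: cvgMr; rewrite expr2; under eq_fun do rewrite expr2.
  by apply: cvgM; exact: cG.
by apply: cvgMr; apply: cvgD; [exact: cL|apply: cvgMr; exact: cP].
Qed.

Lemma perturb_neq0 x : u x != 0 -> \forall r \near 0^', us r x != 0.
Proof.
move=> ux; have c : (fun r => us r x) @ 0^' --> u x.
  apply: (@cvg_to_eq _ _ _ _ (u x + 0 * site z x)); first by ring.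
  by apply: cvgD; [exact: cvg_cst|apply: cvgMl; exact: id0].
exact: (cvgr_neq0 _ c ux).
Qed.

(* The difference quotient converges jointly in the scaling [t] and the step [r];
   homogeneity makes the [t]-dependence explicit. *)
Lemma perturb_quotient_cvg :
  (fun y : R * R => y.2^-1 * (J w a b p h (fun x => y.1 * us y.2 x) -
     J w a b p h (fun x => y.1 * u x))) @ filter_prod (nbhs (1 : R)) 0^'
  --> dJ w a b p h u (site z).
Proof.
set FP := filter_prod _ _.
have FF : Filter FP by exact: filter_prod_filter.
have c1 (f : R -> R) (l : R) : f @ (1 : R) --> l -> (fun y : R * R => f y.1) @ FP --> l.
  by apply: cvg_comp; exact: cvg_fst.
have c2 (f : R -> R) (l : R) : f @ 0^' --> l -> (fun y : R * R => f y.2) @ FP --> l.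
  by apply: cvg_comp; exact: cvg_snd.
pose al r := a * (2 * q + r * Gd) + h z * (2 * u z + r).
(* [al], [ga], [pi] and [la] are the difference quotients in [r] of the quadratic, quartic, power
   and logarithmic parts; [Q] weights them by their homogeneity in [t]. *)
pose ga r := b * ((2 * q + r * Gd) * (G (us r) + G u)).
pose pi r := r^-1 * (abs_pow p (u z + r) - abs_pow p (u z)).
pose la r := r^-1 * (abs_pow_ln p (u z + r) - abs_pow_ln p (u z)).
pose Q (y : R * R) := y.1 ^+ 2 / 2 * al y.2 + y.1 ^+ 4 / 4 * ga y.2
  + y.1 `^ p * (2 / p ^+ 2 * pi y.2 - p^-1 * (la y.2 + ln (y.1 ^+ 2) * pi y.2)).
have E : \forall y \near FP, Q y = y.2^-1 *
    (J w a b p h (fun x => y.1 * us y.2 x) - J w a b p h (fun x => y.1 * u x)).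
  exists ([set t : R | 0 < t], [set r : R | r != 0]) => /=.
    split; first exact: (lt_nbhsr ltr01).
    by near=> r; near: r; exact: nbhs_dnbhs_neq.
  move=> [t r] /= [t0 r0].
  rewrite !JZ//; last exact: perturb_finite_potential.
  rewrite perturb_power perturb_log perturb_potential /Q /= /al /ga /pi /la.
  by rewrite perturb_grad; field; rewrite r0 gt_eqF.
apply: cvg_trans; first exact: (near_eq_cvg E).
pose K := `|u z| `^ (p - 2) * u z.
(* The limit at [t = 1], [r = 0]: the contributions of [2 / p ^+ 2 * (p * K)] and [p^-1 * (2 * K)]
   cancel, leaving the nonlinearity. *)
have E0 : dJ w a b p h u (site z) =
   1 ^+ 2 / 2 * (a * (2 * q + 0 * Gd) + h z * (2 * u z + 0)) +
   1 ^+ 4 / 4 * (b * ((2 * q + 0 * Gd) * (G u + G u))) +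
   1 `^ p * (2 / p ^+ 2 * (p * K) -
     p^-1 * (p * nonlin p (u z) + 2 * K + ln (1 ^+ 2) * (p * K))).
  rewrite dJ_site// -/q !expr1n ln1 powR1; field.
  by rewrite gt_eqF.
apply: (@cvg_to_eq _ _ _ _ _ _ (esym E0)).
have cX n : (fun y : R * R => y.1 ^+ n) @ FP --> (1 : R) ^+ n.
  by apply: (c1 (fun t => t ^+ n)); exact: exprn_continuous.
have cq : (fun y : R * R => 2 * q + y.2 * Gd) @ FP --> 2 * q + 0 * Gd.
  by apply: cvgD; [exact: cvg_cst|apply: cvgMl; apply: (c2 id); exact: id0].
have cpi : (fun y : R * R => pi y.2) @ FP --> p * K.
  by apply: c2; apply: is_derive_quotient; exact: is_derive_abs_pow.
have cla : (fun y : R * R => la y.2) @ FP --> p * nonlin p (u z) + 2 * K.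
  by apply: c2; apply: is_derive_quotient; exact: is_derive_abs_pow_ln.
apply: cvgD; first apply: cvgD.
- apply: cvgM; first by apply: cvgMl; exact: cX.
  apply: cvgD; apply: cvgMr => //.
  by apply: cvgD; [exact: cvg_cst|apply: (c2 id); exact: id0].
- apply: cvgM; first by apply: cvgMl; exact: cX.
  apply: cvgMr; apply: cvgM => //; apply: cvgD; last exact: cvg_cst.
  by apply: (c2 (fun r => G (us r))); exact: cG.
apply: cvgM; first by apply: (c1 (fun t => t `^ p)); exact: powR_continuous_at.
apply: cvgB; first exact: cvgMr.
apply: cvgMr; apply: cvgD => //; apply: cvgM => //.
by apply: (c1 (fun t => ln (t ^+ 2))); exact: ln_sq_continuous_at.
Unshelve. all: by end_near. Qed.

End SitePerturbation.

(** If the derivative [D] were nonzero, take a small [r] of sign opposite to [D]. Some [t] near 1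
    puts [t * us r] on the manifold, so its energy is at least [J u], hence at least that of
    [t * u]. But the quotient has the sign of [D], so the difference is negative. *)
Lemma Nehari_minimizer_site u z : Hs u -> (exists x, u x != 0) -> Nehari_fun u = 0 ->
  (forall v, Hs v -> (exists x, v x != 0) -> Nehari_fun v = 0 ->
     J w a b p h u <= J w a b p h v) ->
  dJ w a b p h u (site z) = 0.
Proof.
move=> su [x0 ux0] Iu umin; apply/eqP/negPn/negP => Dn0.
set D := dJ _ _ _ _ _ _ _ in Dn0 *.
pose us r x := u x + r * site z x.
have cD := perturb_quotient_cvg u z su; rewrite -/D in cD.
have D2 : 0 < D * D by rewrite -expr2 exprn_even_gt0.
have := cvgr_gt _ (cvgM cD (@cvg_cst _ D _ _ _)) 0 D2.
move=> [[/= N1 N2] [nN1 nN2] HN].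
have [e1 /= e10 He1] := (nbhs_ballP _ _).1 nN1.
(* Scalings within [eta] of 1 stay in the neighbourhood [N1] and remain positive. *)
pose eta := Num.min e1 1 / 2.
have m0 : 0 < Num.min e1 1 by rewrite lt_min e10 ltr01.
have eta0 : 0 < eta by rewrite /eta divr_gt0.
have eta1 : eta < 1.
  by rewrite /eta; have : Num.min e1 1 <= 1 by [rewrite ge_min lexx orbT]; lra.
have etae : eta < e1.
  by rewrite /eta; have : Num.min e1 1 <= e1 by [rewrite ge_min lexx]; lra.
have Nt t : 1 - eta <= t -> t <= 1 + eta -> N1 t.
  move=> tlo thi; apply: He1; rewrite -ball_normE /=.
  by rewrite ltr_norml; apply/andP; split; move: eta etae tlo thi {eta0 eta1} => eta; lra.
have tmp : 1 - eta <= 1 + eta by rewrite lerD2l ge0_cp// ltW.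
set A := a * G u + V u; set C := b * G u ^+ 2.
have A0 : 0 < A by rewrite ltr_wpDl ?(potential_part_gt0 _ x0)// mulr_ge0 ?(ltW a0)// grad_part_ge0.
have C0 : 0 <= C by rewrite mulr_ge0 ?(ltW b0)// sqr_ge0.
have LE : L u = A + C by move: Iu; rewrite /Nehari_fun -/A -/C; lra.
have tm : 0 < 1 - eta by rewrite subr_gt0.
have tp : 0 < 1 + eta by rewrite addr_gt0.
have [sm _] := ray_signs A C (P u) _ A0 C0 (power_part_ge0 u) tm.
have [_ sp] := ray_signs A C (P u) _ A0 C0 (power_part_ge0 u) tp.
have cm := perturb_ray_cvg u z su (1 - eta).
have cp := perturb_ray_cvg u z su (1 + eta).
rewrite -/A -/C LE in cm cp.
have t1m : 1 - eta < 1 by rewrite ltrBlDr ltrDl.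
have t1p : 1 < 1 + eta by rewrite ltrDl.
(* The strict signs at [1 - eta] and [1 + eta] persist for small [r], which brackets a root on the
   perturbed ray. *)
have Nm := cvgr_gt _ cm 0 (sm t1m); have Np := cvgr_lt _ cp 0 (sp t1p).
have Nall : \forall r \near (0 : R)^', [/\ N2 r,
    0 < ray p (a * G (us r) + V (us r)) (b * G (us r) ^+ 2) (P (us r)) (L (us r)) (1 - eta),
    ray p (a * G (us r) + V (us r)) (b * G (us r) ^+ 2) (P (us r)) (L (us r)) (1 + eta) < 0 &
    us r x0 != 0].
  near=> r; split; near: r; [exact: nN2|exact: Nm|exact: Np|exact: perturb_neq0].
have [e2 /= e20 He2] := (@nbhs_ballP R R 0 _).1 Nall.
pose r := - (Num.sg D * (e2 / 2)).
have r0 : r != 0 by rewrite /r oppr_eq0 mulf_neq0 ?sgr_eq0// gt_eqF// divr_gt0.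
have rD : r * D < 0.
  rewrite /r mulNr oppr_lt0 mulrAC -normrEsg mulr_gt0 ?normr_gt0// divr_gt0//.
have [|rN2 rm rp rx0] := He2 r _ r0.
  rewrite -ball_normE /= sub0r /r opprK normrM normr_sg Dn0 mul1r gtr0_norm ?divr_gt0//.
  by rewrite ltr_pdivrMr// ltr_pMr// ltr1n.
have su' := perturb_finite_potential u z su r.
have [t /andP[tlo thi] rt] := @ray_root _ p _ _ _ _ (1 - eta) (1 + eta) tm tmp (ltW rm) (ltW rp).
have t0 : 0 < t by exact: lt_le_trans tm tlo.
have : J w a b p h u <= J w a b p h (fun x => t * us r x).
  apply: umin; first exact: finite_potentialZ.
  - by exists x0; rewrite mulf_neq0// gt_eqF.
  - by rewrite Nehari_funZ.
have := J_ray_le_Nehari t u t0 su Iu => J0 J1.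
have /= := HN (t, r) (conj (Nt t tlo thi) rN2); apply/negP; rewrite -leNgt.
set X := _ - _; have X0 : 0 <= X by rewrite subr_ge0 (le_trans J0).
have -> : r^-1 * X * D = X * (r * D) / r ^+ 2 by field.
by rewrite mulr_le0_ge0 ?invr_ge0 ?sqr_ge0// mulr_ge0_le0// ltW.
Unshelve. all: by end_near. Qed.

(** On the Nehari manifold the energy equals the reduced energy, which does not increase when the
    minimiser is scaled by [t <= 1]. The scaled function is thus minimal on the manifold. *)
Lemma exists_ground_state : exists u,
  [/\ Hs u, exists x, u x != 0, Nehari_fun u = 0,
   forall z, dJ w a b p h u (site z) = 0 &
   forall v, Hs v -> (exists x, v x != 0) -> Nehari_fun v = 0 ->
     J w a b p h u <= J w a b p h v].
Proof.
have [u [su [x ux] Iu umin]] := exists_minimizer.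
have [t t01 It] := Nehari_root u x su ux Iu.
have t0 : 0 < t by case/andP: t01.
have st := finite_potentialZ t u su.
have nt : exists y, t * u y != 0 by exists x; rewrite mulf_neq0// gt_eqF.
have tmin v : Hs v -> (exists x, v x != 0) -> Nehari_fun v = 0 ->
    J w a b p h (fun y => t * u y) <= J w a b p h v.
  move=> sv nv Iv; rewrite !J_reduced// It Iv !mulr0 !addr0.
  apply: le_trans (reduced_energyZ_le t u t01 su) _.
  by apply: umin => //; rewrite Iv.
exists (fun y => t * u y); split => // z.
exact: Nehari_minimizer_site.
Qed.

End Energy.

(** * Existence of a ground state *)

Theorem theorem1p1 (R : realType) (d : nat) (s : R)
  (w : Zd d -> Zd d -> R) (a b p : R) (h : Zd d -> R) :
  (1 <= d)%N -> 0 < s < 1 -> weight_ok w s ->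
  0 < a -> 0 < b -> 4 < p ->
  (* (h1) *) (exists h0 : R, 0 < h0 /\ forall x, h0 <= h x) ->
  (* (h2) *) (exists x0 : Zd d, forall M : R, exists r : nat,
                forall x, (r < zdist x x0)%N -> M < h x) ->
  exists u : Zd d -> R,
    in_H w h u /\ Nehari w a b p h u /\ critical w a b p h u /\
    (forall v, Nehari w a b p h v -> J w a b p h u <= J w a b p h v).
Proof.
move=> d1 /andP[s0 _] wok a0 b0 p4 [h0 [h00 hh]] [x0 hc].
have [B wB] := weight_ok_summable _ _ _ _ d1 s0 wok.
(* Balls of the lattice are finite, so [(h2)] makes the sublevel sets of [h] finite. *)
have h_coercive M : exists r : seq (Zd d), forall x, x \notin r -> M < h x.
  have [r Hr] := hc M; have [l Hl] := zball_finite d x0 r; exists l => x xl.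
  by apply: Hr; rewrite ltnNge; apply: contra xl; exact: Hl.
have inHP v := in_H_finite_potential w B h h0 wB h00 hh v.
have [u [su [x ux] Iu Du umin]] :=
  exists_ground_state w B a b p h h0 wB a0 b0 p4 h00 hh h_coercive.
have uH := (inHP u).2 su.
exists u; split => //; split; last split.
- split => //; split; first by move=> u0; rewrite u0 eqxx in ux.
  by rewrite (dJ_self _ B _ _ _ _ h0).
- move=> phi /inHP sphi.
  exact: (critical_of_sites w B a b p h h0 wB a0 b0 p4 h00 hh).
- move=> v [/inHP sv [vn0 Iv]]; apply: umin => //.
    apply: contrapT => /forallNP H; apply: vn0; apply/funext => y.
    by have /negP := H y; rewrite negbK => /eqP.
  by rewrite -(dJ_self _ B _ _ _ _ h0).
Qed.
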